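(* Let $p$ be a prime, $n\ge1$ and $1<\rho<\infty$. The space $\Phi_{\times}(\mathbb{Q}_p^n)$ is dense in $\mathcal{L}^{\rho}(\mathbb{Q}_p^n)$.
   Context: $\mathcal{L}^{\rho}(\mathbb{Q}_p^n)$ is the usual Lebesgue space of complex-valued functions on $\mathbb{Q}_p^n$ with respect to Haar measure $d^nx$ (normalized so that the unit ball has measure $1$). $\mathcal{D}(\mathbb{Q}_p^n)$ is the space of locally constant compactly supported functions $\mathbb{Q}_p^n\to\mathbb{C}$. Fourier transform: $F[\varphi](\xi)=\int_{\mathbb{Q}_p^n}\chi_p(\xi\cdot x)\varphi(x)\,d^nx$, with $\chi_p(\xi\cdot x)=e^{2\pi i\sum_j\{\xi_jx_j\}_p}$, $\{\cdot\}_p$ the $p$-adic fractional part. $\Psi_{\times}(\mathbb{Q}_p^n)=\{\psi\in\mathcal{D}(\mathbb{Q}_p^n):\psi(\xi_1,\dots,\xi_{j-1},0,\xi_{j+1},\dots,\xi_n)=0 \text{ for all } \xi_i\in\mathbb{Q}_p\ (i\neq j),\ j=1,\dots,n\}$, and the Lizorkin space of test functions of the first kind is $\Phi_{\times}(\mathbb{Q}_p^n)=\{F[\psi]:\psi\in\Psi_{\times}(\mathbb{Q}_p^n)\}$. *)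

(* Defs.v *)
From HB Require Import structures.
From mathcomp Require Import all_boot all_order all_algebra.
From mathcomp Require Import all_classical all_reals all_analysis.
From mathcomp Require Import complex.
From mathcomp Require Import ring lra zify.

Set Implicit Arguments.
Unset Strict Implicit.
Unset Printing Implicit Defensive.

Import Order.TTheory GRing.Theory Num.Theory.
Import numFieldNormedType.Exports.

Local Open Scope classical_set_scope.
Local Open Scope ring_scope.
Local Open Scope complex_scope.

(* [logn p] is constantly 0 when p is not prime, so [padic_norm p] is then the
   trivial absolute value: no primality assumption is needed to build Q_p. *)
Definition padic_norm (p : nat) (q : rat) : rat :=
  if q == 0 then 0
  else p%:R ^ ((logn p `|denq q|)%:Z - (logn p `|numq q|)%:Z).

Section PadicNormRat.
Variable p : nat.
Local Notation pnorm := (padic_norm p).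
Implicit Types (q r : rat) (a b : int).

Let vz a : int := (logn p `|a|%N)%:Z.

Lemma padic_norm_div q a b : a != 0 -> b != 0 -> q = a%:~R / b%:~R ->
  pnorm q = p%:R ^ (vz b - vz a).
Proof.
move=> a0 b0 qE.
have bq0 : b%:~R != 0 :> rat by rewrite intr_eq0.
have q0 : q != 0 by rewrite qE mulf_neq0 ?invr_eq0 ?intr_eq0.
rewrite /padic_norm (negPf q0); congr (_ ^ _).
have num0 : numq q != 0 by rewrite numq_eq0.
have /(congr1 (fun z => logn p `|z|%N)) : a * denq q = numq q * b.
  apply: (@intr_inj rat); rewrite !intrM.
  have den0 : (denq q)%:~R != 0 :> rat by rewrite intr_eq0 denq_neq0.
  apply: (mulIf (invr_neq0 bq0)); rewrite mulfK //.
  by rewrite mulrAC -qE -[X in X * _]divq_num_den divfK.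
rewrite !abszM !lognM ?absz_gt0 ?denq_neq0 // /vz; lia.
Qed.

Lemma padic_norm0 : pnorm 0 = 0.
Proof. by rewrite /padic_norm eqxx. Qed.

Lemma padic_norm_gt0 q : q != 0 -> 0 < pnorm q.
Proof.
move=> q0; rewrite /padic_norm (negPf q0).
have [p0|pp] := posnP p; last by rewrite exprz_gt0 // ltr0n.
by rewrite p0 /logn /= subrr expr0z ltr01.
Qed.

Lemma padic_norm_ge0 q : 0 <= pnorm q.
Proof.
by have [->|/padic_norm_gt0/ltW//] := eqVneq q 0; rewrite padic_norm0.
Qed.

Lemma padic_norm_eq0 q : (pnorm q == 0) = (q == 0).
Proof.
have [->|q0] := eqVneq q 0; first by rewrite padic_norm0 eqxx.
by rewrite gt_eqF ?padic_norm_gt0.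
Qed.

Let natr_unit_or_nonprime : (p%:R != 0 :> rat) \/ p = 0%N.
Proof. by case: (p) => [|k]; [right|left; rewrite pnatr_eq0]. Qed.

Lemma padic_normM q r : pnorm (q * r) = pnorm q * pnorm r.
Proof.
have [->|q0] := eqVneq q 0; first by rewrite mul0r padic_norm0 mul0r.
have [->|r0] := eqVneq r 0; first by rewrite mulr0 padic_norm0 mulr0.
have nq : numq q != 0 by rewrite numq_eq0.
have nr : numq r != 0 by rewrite numq_eq0.
rewrite (@padic_norm_div _ (numq q * numq r) (denq q * denq r)).
- rewrite /padic_norm (negPf q0) (negPf r0) /vz.
  rewrite !abszM !lognM ?absz_gt0 ?denq_neq0 //.
  case: natr_unit_or_nonprime => [p0|->].
    by rewrite -expfzDr //; congr (_ ^ _); lia.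
  by rewrite /logn /= !subrr !expr0z mulr1.
- by rewrite mulf_neq0.
- by rewrite mulf_neq0 ?denq_neq0.
by rewrite !intrM invfM mulrACA !divq_num_den.
Qed.

Lemma padic_norm1 : pnorm 1 = 1.
Proof. by rewrite (@padic_norm_div _ 1 1) // subrr expr0z. Qed.

Lemma padic_normN q : pnorm (- q) = pnorm q.
Proof. by rewrite /padic_norm oppr_eq0 numqN denqN abszN. Qed.

Lemma padic_normB q r : pnorm (q - r) = pnorm (r - q).
Proof. by rewrite -padic_normN opprB. Qed.

Lemma padic_normV q : pnorm q^-1 = (pnorm q)^-1.
Proof.
have [->|q0] := eqVneq q 0; first by rewrite padic_norm0 !invr0 padic_norm0.
have nq : pnorm q != 0 by rewrite padic_norm_eq0.
by apply: (mulfI nq); rewrite -padic_normM !divff // padic_norm1.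
Qed.

Lemma padic_normD q r : pnorm (q + r) <= Num.max (pnorm q) (pnorm r).
Proof.
have [->|q0] := eqVneq q 0; first by rewrite add0r padic_norm0 le_max lexx orbT.
have [->|r0] := eqVneq r 0; first by rewrite addr0 padic_norm0 le_max lexx.
have [->|qr0] := eqVneq (q + r) 0; first by rewrite padic_norm0 le_max padic_norm_ge0.
pose a := numq q * denq r; pose b := numq r * denq q; pose d := denq q * denq r.
have dq : (denq q)%:~R != 0 :> rat by rewrite intr_eq0 denq_neq0.
have dr : (denq r)%:~R != 0 :> rat by rewrite intr_eq0 denq_neq0.
have d0 : d != 0 by rewrite mulf_neq0 ?denq_neq0.
have a0 : a != 0 by rewrite mulf_neq0 ?denq_neq0 ?numq_eq0.
have b0 : b != 0 by rewrite mulf_neq0 ?denq_neq0 ?numq_eq0.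
have qE : q = a%:~R / d%:~R.
  by rewrite /a /d !intrM -mulf_div divff // mulr1 divq_num_den.
have rE : r = b%:~R / d%:~R.
  by rewrite /b /d !intrM [X in _ / X]mulrC -mulf_div divff // mulr1 divq_num_den.
have qrE : q + r = (a + b)%:~R / d%:~R by rewrite intrD mulrDl -qE -rE.
have ab0 : a + b != 0.
  by apply: contra qr0 => /eqP ab; rewrite qrE ab mul0r.
rewrite (padic_norm_div a0 d0 qE) (padic_norm_div b0 d0 rE).
rewrite (padic_norm_div ab0 d0 qrE).
have [pp|npp] := boolP (prime p); last first.
  by rewrite /vz /logn (negPf npp) subrr expr0z le_max lexx.
have p1 : 1 <= p%:R :> rat by rewrite ler1n prime_gt0.
suff : (minn (logn p `|a|) (logn p `|b|) <= logn p `|(a + b)%R|)%N.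
  rewrite geq_min => /orP[] h; rewrite le_max; apply/orP; [left|right];
  by apply: ler_weXz2l => //; rewrite /vz lerD2l lerN2 lez_nat.
set m := minn _ _.
have da : ((p ^ m)%N %| a)%Z.
  by rewrite dvdzE /= pfactor_dvdn ?absz_gt0 // geq_minl.
have db : ((p ^ m)%N %| b)%Z.
  by rewrite dvdzE /= pfactor_dvdn ?absz_gt0 // geq_minr.
have := rpredD da db.
by rewrite dvdzE /= pfactor_dvdn ?absz_gt0.
Qed.

Lemma padic_normD_lt e q r : pnorm q < e -> pnorm r < e -> pnorm (q + r) < e.
Proof.
by move=> qe re; rewrite (le_lt_trans (padic_normD q r)) // gt_max qe re.
Qed.

Lemma padic_norm_dominant q r : pnorm r < pnorm q -> pnorm (q + r) = pnorm q.
Proof.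
move=> rq; apply/eqP; rewrite eq_le; apply/andP; split.
  by rewrite (le_trans (padic_normD _ _)) // ge_max lexx ltW.
have := padic_normD (q + r) (- r); rewrite addrK padic_normN le_max.
by case/orP => // /(lt_le_trans rq); rewrite ltxx.
Qed.

End PadicNormRat.

Section CauchySequences.
Variable p : nat.
Local Notation pnorm := (padic_norm p).
Implicit Types (u v : nat -> rat) (e : rat).

Definition padic_cauchy u : Prop :=
  forall e, 0 < e ->
    exists N, forall m n, (N <= m)%N -> (N <= n)%N -> pnorm (u m - u n) < e.

Definition padic_null u : Prop :=
  forall e, 0 < e -> exists N, forall n, (N <= n)%N -> pnorm (u n) < e.

Lemma padic_cauchy_bounded u : padic_cauchy u ->
  exists2 M, 0 < M & forall n, pnorm (u n) < M.
Proof.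
move=> /(_ 1 ltr01)[N uN].
pose M := 1 + \sum_(i < N.+1) pnorm (u i).
have M1 i : (i <= N)%N -> pnorm (u i) < M.
  move=> iN; rewrite /M (bigD1 (Ordinal (iN : (i < N.+1)%N))) //= addrCA.
  by rewrite ltrDl ltr_pwDl // sumr_ge0 // => j _; exact: padic_norm_ge0.
have M1' : 1 <= M.
  by rewrite lerDl sumr_ge0 // => j _; exact: padic_norm_ge0.
exists M => [|n]; first exact: lt_le_trans ltr01 M1'.
have [/M1//|/ltnW Nn] := leqP n N.
rewrite -(subrK (u N) (u n)) padic_normD_lt ?M1 //.
exact: lt_le_trans (uN _ _ Nn (leqnn N)) M1'.
Qed.

Definition padic_cauchy_pred : {pred (nat -> rat)} :=
  fun u => `[< padic_cauchy u >].

Lemma padic_cauchy_subring : GRing.subring_closed padic_cauchy_pred.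
Proof.
split=> [|u v /asboolP uC /asboolP vC|u v /asboolP uC /asboolP vC]; apply/asboolP.
- by move=> e e0; exists 0%N => m n _ _; rewrite subrr padic_norm0.
- move=> e e0; have [N uN] := uC _ e0; have [N' vN] := vC _ e0.
  exists (maxn N N') => m n; rewrite !geq_max => /andP[Nm N'm] /andP[Nn N'n].
  have -> : (u - v) m - (u - v) n = (u m - u n) + (v n - v m).
    have E k : (u - v) k = u k - v k by [].
    by rewrite !E; ring.
  by rewrite padic_normD_lt ?uN ?vN.
move=> e e0; have [A A0 uA] := padic_cauchy_bounded uC.
have [B B0 vB] := padic_cauchy_bounded vC.
have [N uN] := uC _ (divr_gt0 e0 B0); have [N' vN] := vC _ (divr_gt0 e0 A0).
exists (maxn N N') => m n; rewrite !geq_max => /andP[Nm N'm] /andP[Nn N'n].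
have -> : (u * v) m - (u * v) n = (u m - u n) * v m + u n * (v m - v n).
  have E k : (u * v) k = u k * v k by [].
  by rewrite !E; ring.
have ltM (a b c : rat) : 0 < c -> 0 <= a -> 0 <= b -> a < e / c -> b < c -> a * b < e.
  move=> c0 a0 b0 ac bc; rewrite -(divfK (lt0r_neq0 c0) e).
  exact: ltr_pM.
apply: padic_normD_lt; rewrite padic_normM; last rewrite mulrC.
- by apply: (ltM _ _ B) => //; rewrite ?padic_norm_ge0 ?uN.
- by apply: (ltM _ _ A) => //; rewrite ?padic_norm_ge0 ?vN.
Qed.

HB.instance Definition _ :=
  GRing.isSubringClosed.Build (nat -> rat) padic_cauchy_pred padic_cauchy_subring.

End CauchySequences.

Record cauchy_rat (p : nat) := CauchyRat {
  cauchy_seq :> nat -> rat;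
  _ : cauchy_seq \in padic_cauchy_pred p }.

HB.instance Definition _ p := [isSub for @cauchy_seq p].
HB.instance Definition _ p := [Choice of cauchy_rat p by <:].
HB.instance Definition _ p :=
  [SubChoice_isSubComNzRing of cauchy_rat p by <:].

Section NullIdeal.
Variable p : nat.
Local Notation pnorm := (padic_norm p).
Implicit Types u v : cauchy_rat p.

Lemma cauchy_ratP u : padic_cauchy p u.
Proof. by case: u => u /= /asboolP. Qed.

Definition null_ideal : {pred cauchy_rat p} := fun u => `[< padic_null p u >].

Lemma null_idealP u : reflect (padic_null p u) (u \in null_ideal).
Proof. exact: asboolP. Qed.

Lemma null_ideal_closed : idealr_closed null_ideal.
Proof.
split.
- by apply/null_idealP => e e0; exists 0%N => n _; rewrite padic_norm0.
- apply/null_idealP => /(_ 1 ltr01)[N /(_ N (leqnn N))].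
  by rewrite padic_norm1 ltxx.
move=> a u v /null_idealP u0 /null_idealP v0; apply/null_idealP => e e0.
have [A A0 aA] := padic_cauchy_bounded (cauchy_ratP a).
have [N uN] := u0 _ (divr_gt0 e0 A0); have [N' vN] := v0 _ e0.
exists (maxn N N') => n; rewrite geq_max => /andP[Nn N'n].
have -> : (a * u + v) n = a n * u n + v n by [].
rewrite padic_normD_lt ?vN // padic_normM -(divfK (lt0r_neq0 A0) e) mulrC.
by rewrite ltr_pM ?padic_norm_ge0 ?uN.
Qed.

HB.instance Definition _ :=
  isIdealr.Build (cauchy_rat p) null_ideal null_ideal_closed.
End NullIdeal.
Arguments null_ideal : clear implicits.

Definition Qp (p : nat) := {ideal_quot null_ideal p}.
HB.instance Definition _ p := GRing.ComNzRing.on (Qp p).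

Section QpField.
Variable p : nat.
Local Notation pnorm := (padic_norm p).
Implicit Types (u v : cauchy_rat p) (x y : Qp p).

Lemma cauchy_norm_stable u : u \notin null_ideal p ->
  exists2 N, pnorm (u N) != 0 & forall n, (N <= n)%N -> pnorm (u n) = pnorm (u N).
Proof.
move=> /null_idealP u0.
have [e e0 eu] : exists2 e, 0 < e & forall N, exists2 n, (N <= n)%N & e <= pnorm (u n).
  apply: contrapT => h; apply: u0 => e e0; apply: contrapT => h'; apply: h.
  exists e => // N; apply: contrapT => h''; apply: h'; exists N => n Nn.
  by rewrite ltNge; apply/negP => eun; apply: h''; exists n.
have [N uN] := cauchy_ratP u e0; have [M NM eM] := eu N.
exists M => [|n Mn]; first by rewrite gt_eqF // (lt_le_trans e0).
rewrite -(subrK (u M) (u n)) addrC padic_norm_dominant //.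
by rewrite (lt_le_trans _ eM) // uN // (leq_trans NM).
Qed.

Lemma cauchy_inv_subproof u : u \notin null_ideal p ->
  (fun n => (u n)^-1) \in padic_cauchy_pred p.
Proof.
move=> /cauchy_norm_stable[N uN0 uN]; apply/asboolP => e e0.
have uN1 : 0 < pnorm (u N) by rewrite lt_def uN0 padic_norm_ge0.
have [N' uN'] := cauchy_ratP u (mulr_gt0 e0 (mulr_gt0 uN1 uN1)).
exists (maxn N N') => m n; rewrite !geq_max => /andP[Nm N'm] /andP[Nn N'n].
have um0 : u m != 0 by rewrite -(padic_norm_eq0 p) uN.
have un0 : u n != 0 by rewrite -(padic_norm_eq0 p) uN.
have -> : (u m)^-1 - (u n)^-1 = (u n - u m) / (u m * u n).
  by field; rewrite um0 un0.
rewrite padic_normM padic_normV padic_normM !uN //.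
by rewrite ltr_pdivrMr ?mulr_gt0 // uN'.
Qed.

Definition Qp_inv x : Qp p :=
  if x == 0 then 0
  else \pi_(Qp p)%qT (insubd (0 : cauchy_rat p) (fun n => (repr x n)^-1)).

Lemma Qp_pi_eq0 u : (\pi_(Qp p)%qT u == 0) = (u \in null_ideal p).
Proof. by rewrite piE Quotient.equivE subr0. Qed.

Lemma Qp_mulVf x : x != 0 -> Qp_inv x * x = 1.
Proof.
move=> x0; rewrite /Qp_inv (negPf x0).
have u0 : repr x \notin null_ideal p by rewrite -Qp_pi_eq0 reprK.
set v := insubd _ _.
have vE : cauchy_seq v = fun n => (repr x n)^-1.
  by rewrite /v -[LHS]/(val _) insubdK // cauchy_inv_subproof.
rewrite -[X in _ * X]reprK; apply/eqP; rewrite -subr_eq0 piE Quotient.equivE subr0.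
apply/null_idealP => e e0; have [N uN0 uN] := cauchy_norm_stable u0.
exists N => n Nn.
have -> : (v * repr x - 1) n = v n * repr x n - 1 by [].
rewrite vE mulVf ?subrr ?padic_norm0 //.
by rewrite -(padic_norm_eq0 p) uN.
Qed.

Lemma Qp_invr0 : Qp_inv 0 = 0.
Proof. by rewrite /Qp_inv eqxx. Qed.

HB.instance Definition _ :=
  GRing.ComNzRing_isField.Build (Qp p) Qp_mulVf Qp_invr0.

(* The absolute value of Q_p, by continuous extension from Q; its values are
   rational, so it is stated over [rat] and not over the reals. *)
Definition Qp_norm x : rat :=
  lim ((pnorm (repr x n) : rat^o) @[n --> \oo]).

End QpField.

Section QpMetric.
Variable p : nat.
Local Notation pnorm := (padic_norm p).
Implicit Types (u v : cauchy_rat p) (x y : Qp p).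

Lemma Qp_norm0 : Qp_norm (0 : Qp p) = 0.
Proof.
have /null_idealP u0 : repr (0 : Qp p) \in null_ideal p.
  by rewrite -Qp_pi_eq0 reprK eqxx.
apply: (@cvg_lim rat^o) => //; apply/(@cvgrPdist_lt rat rat^o) => e /u0[N uN].
exists N => // n /= /uN; rewrite sub0r normrN ger0_norm //.
exact: padic_norm_ge0.
Qed.

Lemma Qp_norm_eventually x u : \pi_(Qp p)%qT u = x -> x != 0 ->
  exists N, forall n, (N <= n)%N -> pnorm (u n) = Qp_norm x.
Proof.
move=> ux x0; set v := repr x.
have /null_idealP uv : (u - v)%R \in null_ideal p.
  by rewrite Quotient.idealrBE /v reprK -ux.
have v0 : v \notin null_ideal p by rewrite -Qp_pi_eq0 /v reprK.
have [N vN0 vN] := cauchy_norm_stable v0.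
have -> : Qp_norm x = pnorm (v N).
  apply: (@cvg_lim rat^o) => //; apply: cvg_near_cst.
  by exists N => // n /= Nn; rewrite vN.
have vN1 : 0 < pnorm (v N) by rewrite lt_def vN0 padic_norm_ge0.
have [N' uvN] := uv _ vN1; exists (maxn N N') => n.
rewrite geq_max => /andP[Nn N'n].
rewrite -(vN n Nn) -(subrK (v n) (u n)) addrC padic_norm_dominant //.
by rewrite vN // uvN.
Qed.

Lemma Qp_norm_gt0 x : x != 0 -> 0 < Qp_norm x.
Proof.
move=> x0; have [N uN] := Qp_norm_eventually (reprK x) x0.
have /cauchy_norm_stable[N' uN0 uN'] : repr x \notin null_ideal p.
  by rewrite -Qp_pi_eq0 reprK.
rewrite -(uN _ (leq_maxl N N')) uN' ?leq_maxr //.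
by rewrite lt_def uN0 padic_norm_ge0.
Qed.

Lemma Qp_norm_ge0 x : 0 <= Qp_norm x.
Proof. by have [->|/Qp_norm_gt0/ltW//] := eqVneq x 0; rewrite Qp_norm0. Qed.

Lemma Qp_norm_eq0 x : (Qp_norm x == 0) = (x == 0).
Proof.
by have [->|/Qp_norm_gt0/gt_eqF//] := eqVneq x 0; rewrite Qp_norm0 eqxx.
Qed.

Lemma Qp_piM u v :
  \pi_(Qp p)%qT (u * v) = \pi_(Qp p)%qT u * \pi_(Qp p)%qT v.
Proof. exact: Quotient.pi_mul. Qed.

Lemma Qp_piD u v :
  \pi_(Qp p)%qT (u + v) = \pi_(Qp p)%qT u + \pi_(Qp p)%qT v.
Proof. exact: Quotient.pi_add. Qed.

Lemma Qp_piN u : \pi_(Qp p)%qT (- u) = - \pi_(Qp p)%qT u.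
Proof. exact: Quotient.pi_opp. Qed.

Lemma Qp_normM x y : Qp_norm (x * y) = Qp_norm x * Qp_norm y.
Proof.
have [->|x0] := eqVneq x 0; first by rewrite mul0r Qp_norm0 mul0r.
have [->|y0] := eqVneq y 0; first by rewrite mulr0 Qp_norm0 mulr0.
have [N uN] := Qp_norm_eventually (reprK x) x0.
have [N' vN] := Qp_norm_eventually (reprK y) y0.
have uvE : \pi_(Qp p)%qT (repr x * repr y) = x * y by rewrite Qp_piM !reprK.
have [N'' uvN] := Qp_norm_eventually uvE (mulf_neq0 x0 y0).
pose n := (N + N' + N'')%N.
rewrite -(uN n) -?(vN n) -?(uvN n) /n; try lia.
by rewrite -padic_normM.
Qed.

Lemma Qp_normN x : Qp_norm (- x) = Qp_norm x.
Proof.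
have N1 : Qp_norm (-1 : Qp p) = 1.
  have n0 := Qp_norm_gt0 (oner_neq0 (Qp p)).
  have n1 : Qp_norm (1 : Qp p) = 1.
    by apply: (mulfI (lt0r_neq0 n0)); rewrite -Qp_normM !mulr1.
  have : Qp_norm (-1 : Qp p) ^+ 2 = 1 by rewrite expr2 -Qp_normM mulrNN mulr1.
  move/eqP; rewrite sqrf_eq1 => /orP[/eqP//|/eqP nN1].
  by have := Qp_norm_ge0 (-1); rewrite nN1.
by rewrite -mulN1r Qp_normM N1 mul1r.
Qed.

Lemma Qp_normD x y : Qp_norm (x + y) <= Num.max (Qp_norm x) (Qp_norm y).
Proof.
have [->|x0] := eqVneq x 0; first by rewrite add0r le_max lexx orbT.
have [->|y0] := eqVneq y 0; first by rewrite addr0 le_max lexx.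
have [->|xy0] := eqVneq (x + y) 0; first by rewrite Qp_norm0 le_max Qp_norm_ge0.
have [N uN] := Qp_norm_eventually (reprK x) x0.
have [N' vN] := Qp_norm_eventually (reprK y) y0.
have uvE : \pi_(Qp p)%qT (repr x + repr y) = x + y by rewrite Qp_piD !reprK.
have [N'' uvN] := Qp_norm_eventually uvE xy0.
pose n := (N + N' + N'')%N.
rewrite -(uN n) -?(vN n) -?(uvN n) /n; try lia.
exact: padic_normD.
Qed.

Definition Qp_dist x y : rat := Qp_norm (x - y).

Lemma Qp_distxx x : Qp_dist x x = 0.
Proof. by rewrite /Qp_dist subrr Qp_norm0. Qed.

Lemma Qp_dist_positivity x y : Qp_dist x y = 0 -> x = y.
Proof. by move/eqP; rewrite Qp_norm_eq0 subr_eq0 => /eqP. Qed.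

Lemma Qp_dist_sym x y : Qp_dist x y = Qp_dist y x.
Proof. by rewrite /Qp_dist -Qp_normN opprB. Qed.

Lemma Qp_dist_triangle y x z : Qp_dist x z <= Qp_dist x y + Qp_dist y z.
Proof.
rewrite /Qp_dist -[x in x - z](subrK y) -addrA (le_trans (Qp_normD _ _)) //.
by rewrite ge_max lerDl lerDr !Qp_norm_ge0.
Qed.

HB.instance Definition _ := isPointed.Build (Qp p) 0.
HB.instance Definition _ := isMetric.Build rat (Qp p)
  Qp_distxx Qp_dist_positivity Qp_dist_sym Qp_dist_triangle.

End QpMetric.

(* [x = \sum_(k >= -m) a_(k+m) p^k] with digits [a_j] in [{0, .., p-1}];
   leading zeros are allowed, so that every p-adic number has such an expansion
   for all large [m]. *)
Definition padic_expansion (p : nat) (x : Qp p) (m : nat) (a : nat -> nat) :=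
  (forall j, (a j < p)%N) /\
  (\sum_(j < N) (a j)%:R * (p%:R : Qp p) ^ (j%:Z - m%:Z)) @[N --> \oo] --> x.

(* {x}_p, the sum of the terms with negative exponents. *)
Definition padic_frac (p : nat) (x : Qp p) : rat :=
  get [set r : rat | exists m a, padic_expansion x m a /\
         r = \sum_(j < m) (a j)%:R * p%:R ^ (j%:Z - m%:Z)].

Section ComplexFunctions.
Context d (T : measurableType d) (R : realType).
Variable mu : {measure set T -> \bar R}.
Implicit Types (f g : T -> R[i]) (r : R).

Definition cintegral f : R[i] :=
  (\int[mu]_x complex.Re (f x)) +i* (\int[mu]_x complex.Im (f x)).

Definition cmeasurable f : Prop :=
  measurable_fun setT (fun x => complex.Re (f x)) /\
  measurable_fun setT (fun x => complex.Im (f x)).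

Definition cLnorm r f : \bar R :=
  Lnorm mu r%:E (fun x => (ComplexField.Normc.normc (f x))%:E).

Definition cLspace r : set (T -> R[i]) :=
  [set f | cmeasurable f /\ (cLnorm r f < +oo)%E].

Definition dense_in_cLspace r (A : set (T -> R[i])) : Prop :=
  A `<=` cLspace r /\
  forall f, cLspace r f -> forall e : R, 0 < e ->
    exists2 g, A g & (cLnorm r (fun x => f x - g x)%R < e%:E)%E.

End ComplexFunctions.

Notation borelQp p n := (g_sigma_algebraType (@open 'rV[Qp p]_n)).

Definition Qp_unit_ball p n : set 'rV[Qp p]_n :=
  [set x | forall j, Qp_norm (x 0 j) <= 1].

(* On the second countable locally compact group [Q_p^n] these two conditions
   characterize the Haar measure. *)
Definition normalized_haar p n (R : realType)
    (mu : {measure set (borelQp p n) -> \bar R}) : Prop :=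
  (forall (x : 'rV[Qp p]_n) (A : set (borelQp p n)), measurable A ->
     mu [set x + y | y in A] = mu A) /\
  mu (@Qp_unit_ball p n) = 1%E.

Section Lizorkin.
Variables (p n : nat) (R : realType).
Variable mu : {measure set (borelQp p n) -> \bar R}.
Implicit Types (x xi : 'rV[Qp p]_n) (phi psi : 'rV[Qp p]_n -> R[i]).

Definition cis (t : R) : R[i] := cos t +i* sin t.

Definition Qp_character xi x : R[i] :=
  cis (2 * pi * ratr (\sum_j padic_frac (xi 0 j * x 0 j))).

Definition fourier phi xi : R[i] :=
  cintegral mu (fun x : borelQp p n => Qp_character xi x * phi x).

Definition locally_constant phi : Prop :=
  forall x, \forall y \near x, phi y = phi x.

Definition compactly_supported phi : Prop :=
  compact (closure [set x | phi x != 0]).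

Definition test_functions : set ('rV[Qp p]_n -> R[i]) :=
  [set phi | locally_constant phi /\ compactly_supported phi].

Definition Psi_cross : set ('rV[Qp p]_n -> R[i]) :=
  [set psi | test_functions psi /\
     forall j xi, xi 0 j = 0 -> psi xi = 0].

Definition Phi_cross : set ('rV[Qp p]_n -> R[i]) :=
  [set fourier psi | psi in Psi_cross].

End Lizorkin.

(* Main.v *)
(** For a compact open box H = {x | |x_j| <= p^(k_j)}, orthogonality of characters
    gives F[1_H] = mu(H) 1_(H^perp) with mu(H) mu(H^perp) = 1.  To approximate the
    indicator of a cube with centre a in L^rho, modulate by the character of -a and
    take psi(xi) = const * prod_j (1[|xi_j| <= p^(-z)] - 1[|xi_j| <= p^(-t)]), which
    vanishes on the coordinate hyperplanes.  Expanding the product, F[psi] is the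
    indicator of the cube plus finitely many error terms mu(H) 1_(a + H^perp), where H
    has a side p^(-t); their norms mu(H) mu(H^perp)^(1/rho) = mu(H)^(1 - 1/rho) tend to
    0 as t grows, since rho > 1.  Two cubes are nested or disjoint, so cubes form a
    pi-system generating the Borel sets; a lambda-system argument and dominated
    convergence then yield all of L^rho.  Conversely every test function is a finite
    combination of indicators of cubes, so Fourier transforms of test functions are
    test functions and Phi_cross is contained in L^rho. *)
From HB Require Import structures.
Require Import Defs.
From mathcomp Require Import all_boot all_order all_algebra.
From mathcomp Require Import all_classical all_reals all_analysis.
From mathcomp Require Import measurable_realfun complex ring lra zify.

Set Implicit Arguments.
Unset Strict Implicit.
Unset Printing Implicit Defensive.

Import Order.TTheory GRing.Theory Num.Theory.
Import numFieldNormedType.Exports.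

Local Open Scope classical_set_scope.
Local Open Scope ring_scope.

(** * The field of p-adic numbers *)

(** [padic_frac] picks its value by [get] among all expansions, so it is never computed. All that is
    used is that it is a rational with p-power denominator and differs from its argument by a p-adic
    integer. A rational with such a denominator and norm at most 1 is an integer, so every identity
    between characters reduces to a norm bound in each coordinate. The condition [1 < rho] reflects
    a genuine obstruction: [psi 0 = 0] forces the integral of F[psi] to vanish, and this survives
    limits in L^1, so no indicator of a cube can be reached there. For larger [rho] the compensating
    mass can be spread thinly over a long box, at a small cost in norm. The passage from cubes to
    L^rho is carried out on an abstract measure space with a generating pi-system and an exhaustion
    by members of finite measure; only the cubes bring in p-adic geometry. *)

Section RatEmbedding.
Variable p : nat.
Local Notation pnorm := (padic_norm p).
Implicit Types (q : rat) (x y : Qp p).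

Lemma cst_cauchy q : (fun=> q) \in padic_cauchy_pred p.
Proof.
by apply/asboolP => e e0; exists 0%N => m n _ _; rewrite subrr padic_norm0.
Qed.

Definition Qp_of_rat q : Qp p := \pi_(Qp p)%qT (CauchyRat (cst_cauchy q)).

Lemma Qp_of_rat_is_zmod_morphism : zmod_morphism Qp_of_rat.
Proof.
move=> q r; rewrite /Qp_of_rat -Qp_piN -Qp_piD; congr (\pi_(Qp p)%qT _).
exact/val_inj.
Qed.

Lemma Qp_of_rat_is_monoid_morphism : monoid_morphism Qp_of_rat.
Proof.
split; last first.
  move=> q r; rewrite /Qp_of_rat -Qp_piM; congr (\pi_(Qp p)%qT _).
  exact/val_inj.
have -> : 1 = \pi_(Qp p)%qT (1 : cauchy_rat p) by rewrite piE.
by congr (\pi_(Qp p)%qT _); exact/val_inj.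
Qed.

HB.instance Definition _ :=
  GRing.isZmodMorphism.Build rat (Qp p) Qp_of_rat Qp_of_rat_is_zmod_morphism.
HB.instance Definition _ :=
  GRing.isMonoidMorphism.Build rat (Qp p) Qp_of_rat Qp_of_rat_is_monoid_morphism.

Lemma Qp_norm_of_rat q : Qp_norm (Qp_of_rat q) = pnorm q.
Proof.
have [->|q0] := eqVneq q 0; first by rewrite rmorph0 Qp_norm0 padic_norm0.
have q0' : Qp_of_rat q != 0 by rewrite fmorph_eq0.
by have [N /(_ N (leqnn N)) <-] := Qp_norm_eventually (erefl (Qp_of_rat q)) q0'.
Qed.

Lemma Qp_of_rat_dense x (e : rat) : 0 < e ->
  exists q, Qp_norm (x - Qp_of_rat q) < e.
Proof.
move=> e0; have [N uN] := cauchy_ratP (repr x) e0.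
(* The approximant is a term of the Cauchy representative beyond its index for [e]. *)
exists (repr x N); set y := _ - _.
have [->|y0] := eqVneq y 0; first by rewrite Qp_norm0.
have yE : \pi_(Qp p)%qT (repr x - CauchyRat (cst_cauchy (repr x N))) = y.
  by rewrite Qp_piD Qp_piN reprK.
have [M yM] := Qp_norm_eventually yE y0.
by rewrite -(yM _ (leq_maxr N M)); apply: uN; rewrite ?leq_maxl.
Qed.

Lemma Qp_normB x y : Qp_norm (x - y) = Qp_norm (y - x).
Proof. by rewrite -Qp_normN opprB. Qed.

Lemma Qp_norm1 : Qp_norm (1 : Qp p) = 1.
Proof. by rewrite -(rmorph1 Qp_of_rat) Qp_norm_of_rat padic_norm1. Qed.

Lemma Qp_normV x : Qp_norm x^-1 = (Qp_norm x)^-1.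
Proof.
have [->|x0] := eqVneq x 0; first by rewrite invr0 Qp_norm0 invr0.
have nx : Qp_norm x != 0 by rewrite Qp_norm_eq0.
by apply: (mulfI nx); rewrite -Qp_normM !divff // Qp_norm1.
Qed.

Lemma Qp_normD_le e x y : Qp_norm x <= e -> Qp_norm y <= e ->
  Qp_norm (x + y) <= e.
Proof. by move=> xe ye; rewrite (le_trans (Qp_normD x y))// ge_max xe ye. Qed.

Lemma Qp_normB_le e x y : Qp_norm x <= e -> Qp_norm y <= e ->
  Qp_norm (x - y) <= e.
Proof. by move=> xe ye; rewrite Qp_normD_le// Qp_normN. Qed.

Lemma padic_norm_int (a : int) : pnorm a%:~R <= 1.
Proof.
have [->|a0] := eqVneq a 0; first by rewrite padic_norm0.
rewrite (@padic_norm_div p _ a 1) ?divr1// logn1 sub0r.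
(* For [p = 0] the valuation [logn] is 0 by default, and the bound reads [1 <= 1]. *)
have [->|p0] := posnP p; first by rewrite /logn /= expr0z.
by rewrite -exprnN invf_le1 ?exprn_gt0 ?ltr0n// exprn_ege1// ler1n.
Qed.

End RatEmbedding.

(** * Prime p: discrete values, digits and the fractional part *)

Section PrimeNorm.
Variable p : nat.
Hypothesis p_prime : prime p.
Local Notation pnorm := (padic_norm p).
Local Notation pr := (p%:R : rat).
Implicit Types (q : rat) (x y : Qp p).

Let p_gt0 : 0 < pr. Proof. by rewrite ltr0n prime_gt0. Qed.
Let p_gt1 : 1 < pr. Proof. by rewrite ltr1n prime_gt1. Qed.
Let p_neq0 : pr != 0. Proof. by rewrite gt_eqF. Qed.

Lemma padic_norm_p : pnorm pr = pr^-1.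
Proof.
rewrite (@padic_norm_div p _ p 1) ?divr1//.
  by rewrite logn1 sub0r /= logn_prime// eqxx -exprN1.
by move: p_prime; case: (p).
Qed.

Lemma Qp_norm_expp (z : int) : Qp_norm ((p%:R : Qp p) ^ z) = pr ^ (- z).
Proof.
have n1 : Qp_norm (p%:R : Qp p) = pr^-1.
  by rewrite -(rmorph_nat (@Qp_of_rat p)) Qp_norm_of_rat padic_norm_p.
have nX (k : nat) : Qp_norm ((p%:R : Qp p) ^+ k) = pr^-1 ^+ k.
  elim: k => [|k IH]; first by rewrite !expr0 Qp_norm1.
  by rewrite !exprS Qp_normM IH n1.
case: z => k; first by rewrite -exprnP nX exprVn exprnN.
by rewrite NegzE opprK -exprnN Qp_normV nX exprVn invrK.
Qed.

Lemma Qp_p_neq0 : (p%:R : Qp p) != 0.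
Proof.
by rewrite -(rmorph_nat (@Qp_of_rat p)) fmorph_eq0.
Qed.

(** The norm of a nonzero [x] is attained along its Cauchy representative, hence is already the norm
    of a rational. *)
Lemma Qp_norm_value x : x != 0 -> exists z : int, Qp_norm x = pr ^ z.
Proof.
move=> x0; have [N uN] := Qp_norm_eventually (reprK x) x0.
have := uN _ (leqnn N); rewrite /padic_norm; case: eqP => [_ /esym/eqP|_ <-].
  by rewrite Qp_norm_eq0 (negPf x0).
by eexists.
Qed.

Lemma Qp_norm_le_exp x : exists m : nat, Qp_norm x <= pr ^ m%:Z.
Proof.
have [->|/Qp_norm_value[z ->]] := eqVneq x 0.
  by exists 0%N; rewrite Qp_norm0 expr0z.
exists `|z|%N; rewrite ler_eXz2l//; lia.
Qed.

(** The values are powers of [p], so a strict bound gains a full factor [p]. *)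
Lemma Qp_norm_lt_exp x (z : int) : Qp_norm x < pr ^ z -> Qp_norm x <= pr ^ (z - 1).
Proof.
have [->|/Qp_norm_value[w ->]] := eqVneq x 0.
  by rewrite Qp_norm0 exprz_ge0// ltW.
by rewrite ltr_eXz2l// ler_eXz2l//; lia.
Qed.

(** Only [p] can occur in the denominator, and the norm bound cancels it. Differences of fractional
    parts are shown to be integers through this criterion. *)
Lemma padic_integer q (a : int) (k : nat) :
  q = a%:~R / pr ^+ k -> pnorm q <= 1 -> q \is a Num.int.
Proof.
move=> qE; have [a0 _|a0] := eqVneq a 0.
  by rewrite qE a0 mul0r rpred0.
have pk0 : (p ^ k)%N%:Z != 0 by rewrite eqz_nat -lt0n expn_gt0 prime_gt0.
rewrite (@padic_norm_div p q a (p ^ k)%N%:Z)//; last first.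
  by rewrite qE -pmulrn natrX.
rewrite /= pfactorK// -[X in _ <= X](expr0z pr) ler_eXz2l// subr_le0 lez_nat.
move=> ka; have /dvdzP[b ab] : ((p ^ k)%N%:Z %| a)%Z.
  by rewrite dvdzE /= pfactor_dvdn ?absz_gt0.
by rewrite qE ab intrM -pmulrn natrX mulfK ?expf_neq0// intr_int.
Qed.

(** The residue field is F_p: [x] is replaced by a close rational [q], and [d] is the numerator of
    [q] divided by its denominator modulo [p]. *)
Lemma padic_digit x : Qp_norm x <= 1 ->
  exists2 d, (d < p)%N & Qp_norm (x - d%:R) <= pr^-1.
Proof.
move=> x1; have [q xq] : exists q, Qp_norm (x - Qp_of_rat p q) < pr^-1.
  by apply: Qp_of_rat_dense; rewrite invr_gt0.
suff [d dp qd] : exists2 d, (d < p)%N & pnorm (q - d%:R) <= pr^-1.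
  exists d => //; rewrite -(subrK (Qp_of_rat p q) x) -addrA Qp_normD_le ?(ltW xq)//.
  by rewrite -(rmorph_nat (@Qp_of_rat p)) -rmorphB Qp_norm_of_rat.
have q1 : pnorm q <= 1.
  rewrite -(Qp_norm_of_rat p q) -[Qp_of_rat p q](subKr x) Qp_normB_le//.
  by rewrite (le_trans (ltW xq))// invf_le1// ltW.
have [->|q0] := eqVneq q 0.
  exists 0%N; first exact: prime_gt0.
  by rewrite subrr padic_norm0 invr_ge0 ltW.
(* If [p] divided the denominator it would not divide the numerator, and the norm of [q] would
   exceed 1. *)
have cpd : coprimez p (denq q).
  rewrite coprimezE /= prime_coprime//; apply/negP => pd.
  have : coprime p `|numq q|.
    by apply: coprime_dvdl pd _; rewrite coprime_sym coprime_num_den.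
  rewrite prime_coprime// => /negP pn.
  move: q1; rewrite /padic_norm (negPf q0) -[X in _ <= X](expr0z pr) ler_eXz2l//.
  rewrite subr_le0 lez_nat [X in (_ <= X)%N]lognE (negPf (introN idP pn)) !andbF.
  by rewrite leqn0 -[_ == _]negbK -lt0n logn_gt0 mem_primes p_prime pd absz_gt0 denq_neq0.
have [[u v] /= uv] := coprimezP _ _ cpd.
(* By Bezout, [v] inverts the denominator modulo [p]; the [c] below is the quotient of
   [numq q - d * denq q] by [p]. *)
pose d := ((numq q * v) %% p)%Z.
have dge : 0 <= d by rewrite modz_ge0// eqz_nat -lt0n prime_gt0.
have dlt : d < p by rewrite ltz_pmod// ltz_nat prime_gt0.
have dE : (`|d|%N%:R : rat) = d%:~R by rewrite pmulrn gez0_abs.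
exists `|d|%N; first by rewrite -ltz_nat gez0_abs.
pose c := numq q * u + ((numq q * v) %/ p)%Z * denq q.
have den0 : (denq q)%:~R != 0 :> rat by rewrite intr_eq0 denq_neq0.
have -> : q - `|d|%:R = pr * (c%:~R / (denq q)%:~R).
  rewrite dE; have : numq q - d * denq q = p%:Z * c.
    have := divz_eq (numq q * v) p; rewrite -/d /c; move: (_ %/ _)%Z => t e1.
    by rewrite -[X in X - _]mulr1 -uv mulrDr [numq q * (v * _)]mulrA e1; ring.
  move/(congr1 (fun z => z%:~R : rat)); rewrite intrB !intrM => e2.
  apply: (mulIf den0); rewrite mulrBl -{1}(divq_num_den q) divfK// mulrA divfK//.
rewrite !padic_normM padic_norm_p ler_piMr ?invr_ge0 ?(ltW p_gt0)// padic_normV.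
have -> : pnorm (denq q)%:~R = 1.
  rewrite (@padic_norm_div p _ (denq q) 1) ?denq_neq0 ?divr1// logn1 sub0r.
  rewrite logn_coprime; first by rewrite oppr0 expr0z.
  by move: cpd; rewrite coprimezE.
by rewrite invr1 mulr1 padic_norm_int.
Qed.

Lemma padic_digit_ball x (z : int) : Qp_norm x <= pr ^ z ->
  exists2 d, (d < p)%N & Qp_norm (x - d%:R * p%:R ^ (- z)) <= pr ^ (z - 1).
Proof.
move=> xz; have : Qp_norm (x * p%:R ^ z) <= 1.
  by rewrite Qp_normM Qp_norm_expp -ler_pdivlMr ?exprz_gt0// invr_expz opprK mul1r.
move=> /padic_digit[d dp xd]; exists d => //.
have -> : x - d%:R * p%:R ^ (- z) = (x * p%:R ^ z - d%:R) * p%:R ^ (- z).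
  by rewrite mulrBl -mulrA -expfzDr ?Qp_p_neq0// subrr expr0z mulr1.
rewrite Qp_normM Qp_norm_expp opprK expfzDr// exprN1 [X in _ <= X]mulrC.
by apply: ler_wpM2r => //; rewrite exprz_ge0// ltW.
Qed.

(** The bound makes [(d - e) / p] an integer, of absolute value below 1. Disjointness of the
    translates in [haar_box_step] rests on this. *)
Lemma padic_digit_unique (d e : nat) (z : int) : (d < p)%N -> (e < p)%N ->
  Qp_norm (d%:R * p%:R ^ (- z) - e%:R * p%:R ^ (- z) : Qp p) <= pr ^ (z - 1) ->
  d = e.
Proof.
move=> dp ep; rewrite -mulrBl Qp_normM Qp_norm_expp opprK expfzDr// mulrC.
rewrite ler_pM2l ?exprz_gt0// exprN1 -!(rmorph_nat (@Qp_of_rat p)) -rmorphB.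
rewrite Qp_norm_of_rat => de.
have /intrP[m] : (d%:R - e%:R) / pr \is a Num.int.
  apply: (@padic_integer _ (d%:Z - e%:Z) 1); first by rewrite intrD mulrNz.
  by rewrite padic_normM padic_normV padic_norm_p invrK -ler_pdivlMr// mul1r.
move=> /(canRL (mulfVK p_neq0)).
have -> : d%:R - e%:R = (d%:Z - e%:Z)%:~R :> rat by rewrite intrD mulrNz.
have -> : m%:~R * pr = (m * p%:Z)%:~R by rewrite intrM.
move=> /intr_inj dem; have m0 : m = 0 by nia.
by move: dem; rewrite m0 mul0r; lia.
Qed.

(* Bounding the error of every truncation makes uniqueness of digits irrelevant. *)
Lemma padic_digits x (m : int) : Qp_norm x <= pr ^ m ->
  exists2 a : nat -> nat, forall j, (a j < p)%N &
  forall N : nat, Qp_norm (x - \sum_(j < N) (a j)%:R * (p%:R : Qp p) ^ (j%:Z - m))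
    <= pr ^ (m - N%:Z).
Proof.
move=> xm.
(* The implication stands under the existential so that choice gives a total digit function [f]. *)
have step (y : Qp p) : exists d : nat, Qp_norm y <= 1 ->
    (d < p)%N /\ Qp_norm ((y - d%:R) / p%:R) <= 1.
  have [y1|y1] := leP (Qp_norm y) 1; last by exists 0%N.
  have [d dp yd] := padic_digit y1; exists d => _; split=> //.
  rewrite Qp_normM -exprN1 Qp_norm_expp opprK expr1z.
  by rewrite -ler_pdivlMr// mul1r.
pose f y := projT1 (cid (step y)).
have fP y : Qp_norm y <= 1 -> (f y < p)%N /\ Qp_norm ((y - (f y)%:R) / p%:R) <= 1.
  exact: (projT2 (cid (step y))).
(* [r k] is the k-th remainder: [x * p ^ m] minus its first [k] digits, divided by [p ^ k]. *)
pose r := fix r k := if k is k'.+1 then (r k' - (f (r k'))%:R) / p%:R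
                     else x * p%:R ^ m.
have r1 k : Qp_norm (r k) <= 1.
  elim: k => [|k IH] /=; last by have [] := fP _ IH.
  by rewrite Qp_normM Qp_norm_expp -ler_pdivlMr ?exprz_gt0// -invr_expz invrK mul1r.
exists (fun j => f (r j)) => [j|N]; first by have [] := fP _ (r1 j).
have -> : x - \sum_(j < N) (f (r j))%:R * (p%:R : Qp p) ^ (j%:Z - m)
    = r N * p%:R ^ (N%:Z - m).
  elim: N => [|N IH].
    by rewrite big_ord0 subr0 /= -mulrA -expfzDr ?Qp_p_neq0// sub0r subrr expr0z mulr1.
  rewrite big_ord_recr opprD addrA IH /= -mulrBl -mulrA -addn1 PoszD addrAC.
  rewrite [in RHS]expfzDr ?Qp_p_neq0// expr1z [p%:R^-1 * _]mulrCA.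
  by rewrite mulVf ?Qp_p_neq0// mulr1.
rewrite Qp_normM Qp_norm_expp opprB -[X in _ <= X]mul1r.
by rewrite ler_wpM2r ?exprz_ge0// ltW.
Qed.

Lemma Qp_ballE x (e : rat) : ball x e = [set y | Qp_norm (x - y) < e].
Proof. by rewrite ballEmdist. Qed.

Lemma Qp_cvgP (u : nat -> Qp p) x :
  u @ \oo --> x <->
  forall e : rat, 0 < e -> \forall N \near \oo, Qp_norm (x - u N) < e.
Proof.
split=> [/cvg_ballP ux e /ux|ux].
  by apply: filterS => N; rewrite Qp_ballE.
by apply/cvg_ballP => e /ux; apply: filterS => N; rewrite Qp_ballE.
Qed.

(** Stated over any archimedean field because radii are rational while measures are real. *)
Lemma pexpN_lt (F : archiRealFieldType) (e : F) : 0 < e ->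
  exists M : nat, (p%:R : F) ^ (- M%:Z) < e.
Proof.
move=> e0; exists (Num.bound e^-1).
rewrite -exprnN -[e in _ < e]invrK.
rewrite ltf_pV2 ?posrE ?invr_gt0 ?exprn_gt0 ?ltr0n ?prime_gt0//.
apply: (lt_trans (archi_boundP _)); first by rewrite invr_ge0 ltW.
by rewrite -natrX ltr_nat ltn_expl ?prime_gt1.
Qed.

(** Existence of an expansion makes the [get] in [padic_frac] meaningful. The two properties fix the
    value modulo integers, which is all that a character sees. *)
Lemma padic_fracP x : exists (a : int) (k : nat),
  padic_frac x = a%:~R / pr ^+ k /\ Qp_norm (x - Qp_of_rat p (padic_frac x)) <= 1.
Proof.
have : exists r : rat, (exists m a, padic_expansion x m a /\
         r = \sum_(j < m) (a j)%:R * p%:R ^ (j%:Z - m%:Z)) :> Prop.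
  have [m xm] := Qp_norm_le_exp x; have [a ap xa] := padic_digits xm.
  eexists; exists m, a; split; last reflexivity.
  split=> //; apply/Qp_cvgP => e e0; have [M Me] := pexpN_lt e0.
  exists (m + M)%N => //= N /= mN; rewrite (le_lt_trans (xa N))//.
  by rewrite (le_lt_trans _ Me)// ler_eXz2l//; lia.
move=> /(@getPex _ [set r | exists m a, _]) [m [a [[ap xa] frE]]].
have pX (j : 'I_m) : pr ^ (j%:Z - m%:Z) = pr ^+ j / pr ^+ m.
  by rewrite expfzDr// exprnN.
exists (\sum_(j < m) (a j)%:Z * (p ^ j)%N), m; split.
  rewrite [padic_frac x]frE raddf_sum mulr_suml; apply: eq_bigr => j _.
  by rewrite pX /= intrM -!pmulrn natrX mulrA.
rewrite [padic_frac x]frE.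
(* Take a partial sum within distance 1 of [x] that contains all [m] terms of negative exponent; its
   other terms are p-adic integers. *)
have {xa} /Qp_cvgP/(_ 1 ltr01)[N _ xN] := xa.
have {xN} := xN (N + m)%N (leq_addr _ _).
rewrite addnC big_split_ord /= opprD addrA => xN.
have -> : Qp_of_rat p (\sum_(j < m) (a j)%:R * pr ^ (j%:Z - m%:Z)) =
    \sum_(i < m) (a i)%:R * (p%:R : Qp p) ^ (i%:Z - m%:Z).
  rewrite rmorph_sum; apply: eq_bigr => j _ /=.
  by rewrite rmorphM rmorph_nat fmorphXz rmorph_nat.
set s := \sum_(i < m) _ in xN *; set t := \sum_(i < N) _ in xN.
rewrite -[x - s](subrK t); apply: (Qp_normD_le (ltW xN)); rewrite /t {xN}.
elim/big_ind: _ => [|y z|i _]; first by rewrite Qp_norm0.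
  exact: Qp_normD_le.
rewrite Qp_normM Qp_norm_expp -(rmorph_nat (@Qp_of_rat p)) Qp_norm_of_rat.
rewrite -[X in _ <= X]mulr1 ler_pM ?padic_norm_ge0 ?exprz_ge0 ?(ltW p_gt0)//.
  by rewrite pmulrn; exact: padic_norm_int.
by rewrite -[X in _ <= X](expr0z pr) ler_eXz2l//; lia.
Qed.

(** The combination has p-power denominator and differs from [x + y - z] by p-adic integers, so
    [padic_integer] applies. Leaving [z] free yields additivity and invariance under Z_p
    together. *)
Lemma padic_frac_int x y z : Qp_norm (x + y - z) <= 1 ->
  padic_frac x + padic_frac y - padic_frac z \is a Num.int.
Proof.
move=> xyz; have [a [k [xE x1]]] := padic_fracP x.
have [b [l [yE y1]]] := padic_fracP y; have [c [m [zE z1]]] := padic_fracP z.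
set q := _ - _.
have qE : q = (a * (p ^ (l + m))%N + b * (p ^ (k + m))%N - c * (p ^ (k + l))%N)%:~R
   / pr ^+ (k + l + m).
  rewrite /q xE yE zE !(intrD, intrM, intrN, mulNr) -!pmulrn !natrX !exprD.
  by field; rewrite !expf_neq0.
apply: (padic_integer qE); rewrite -(Qp_norm_of_rat p).
rewrite /q rmorphB rmorphD /=.
set fx := Qp_of_rat p _ in x1 *; set fy := Qp_of_rat p (padic_frac y) in y1 *.
set fz := Qp_of_rat p (padic_frac z) in z1 *.
have -> : fx + fy - fz = (x + y - z) - (x - fx) - (y - fy) + (z - fz) by ring.
exact: (Qp_normD_le (Qp_normB_le (Qp_normB_le xyz x1) y1) z1).
Qed.

End PrimeNorm.

(** * Boxes and test functions *)

Section QpCompact.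
Variable p : nat.
Hypothesis p_prime : prime p.
Local Notation pr := (p%:R : rat).

Let p_gt0 : 0 < pr. Proof. by rewrite ltr0n prime_gt0. Qed.
Let p_gt1 : 1 < pr. Proof. by rewrite ltr1n prime_gt1. Qed.

Lemma Qp_norm_pi_le (u : cauchy_rat p) (q e : rat) (N : nat) : 0 <= e ->
  (forall n, (N <= n)%N -> padic_norm p (u n - q) <= e) ->
  Qp_norm (\pi_(Qp p)%qT u - Qp_of_rat p q) <= e.
Proof.
move=> e0 ue; set y := _ - _.
have [->|y0] := eqVneq y 0; first by rewrite Qp_norm0.
have yE : \pi_(Qp p)%qT (u - CauchyRat (cst_cauchy p q)) = y.
  by rewrite Qp_piD Qp_piN.
have [M yM] := Qp_norm_eventually yE y0.
by rewrite -(yM _ (leq_maxr N M)); apply: ue; rewrite leq_maxl.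
Qed.

(** A ball is the union of [p] balls whose radius is [p] times smaller, so an ultrafilter selects
    one at each level. The centres are kept rational: their sequence is then itself a Cauchy
    representative of the limit. *)
Lemma Qp_ball_compact (m : int) : compact [set x : Qp p | Qp_norm x <= pr ^ m].
Proof.
rewrite compact_ultra => F FU Fm.
pose B (c : rat) k : set (Qp p) :=
  [set x | Qp_norm (x - Qp_of_rat p c) <= pr ^ (m - k%:Z)].
have step k c : exists c', F (B c k) -> F (B c' k.+1).
  apply: contrapT => /forallNP h.
  (* If none of the [p] subballs belonged to [F], the ball minus all of them would; but each of its
     points has a leading digit. *)
  pose z := m - k%:Z; pose c' (d : 'I_p) := c + d%:R * pr ^ (- z).
  have FB : F (B c k) by apply: contrapT => nF; apply: (h 0).
  have FN d : F (~` B (c' d) k.+1).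
    have [FB'|//] := in_ultra_setVsetC (B (c' d) k.+1) FU.
    by case: (h (c' d)).
  have [x [xB xN]] : exists x, (B c k `&` [set x | forall d, (~` B (c' d) k.+1) x]) x.
    by apply: (@filter_ex _ F); apply: filterI => //; exact: filter_forall.
  have [d dp xd] := padic_digit_ball p_prime xB; apply: (xN (Ordinal dp)).
  rewrite /B /= /c' /= rmorphD rmorphM rmorph_nat fmorphXz rmorph_nat opprD addrA.
  by have -> : m - k.+1%:Z = z - 1 by rewrite /z; lia.
pose r := fix r k := if k is k'.+1 then projT1 (cid (step k' (r k'))) else 0.
have Fr k : F (B (r k) k).
  elim: k => [|k IH]; last exact: (projT2 (cid (step k (r k)))).
  by apply: filterS Fm => x; rewrite /B /= rmorph0 !subr0.
have rr k l : (k <= l)%N -> padic_norm p (r l - r k) <= pr ^ (m - k%:Z).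
  move=> kl; have [x [xk xl]] : (B (r k) k `&` B (r l) l) !=set0.
    by apply: (@filter_ex _ F); exact: filterI.
  rewrite -(Qp_norm_of_rat p) rmorphB /=.
  have -> : Qp_of_rat p (r l) - Qp_of_rat p (r k) =
    (x - Qp_of_rat p (r k)) - (x - Qp_of_rat p (r l)) by ring.
  apply: Qp_normB_le; first exact: xk.
  by apply: (le_trans xl); rewrite ler_eXz2l//; lia.
have rC : r \in padic_cauchy_pred p.
  apply/asboolP => e e0.
  have [M Me] := pexpN_lt p_prime (divr_gt0 e0 (exprz_gt0 m p_gt0)).
  have Me' : pr ^ (m - M%:Z) < e.
    by rewrite expfzDr ?gt_eqF// mulrC -ltr_pdivlMr ?exprz_gt0.
  exists M => k l Mk Ml; rewrite -[r k](subrK (r M)) -addrA.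
  rewrite padic_normD_lt ?[padic_norm p (r M - _)]padic_normB//;
    exact: le_lt_trans (rr _ _ _) Me'.
pose x := \pi_(Qp p)%qT (CauchyRat rC).
have xr k : Qp_norm (x - Qp_of_rat p (r k)) <= pr ^ (m - k%:Z).
  by apply: (@Qp_norm_pi_le _ _ _ k) => [|l /rr//]; rewrite exprz_ge0 ?(ltW p_gt0).
exists x; split; first by have := xr 0%N; rewrite /= rmorph0 !subr0.
apply/cvg_ballP => e e0.
have [M Me] := pexpN_lt p_prime (divr_gt0 e0 (exprz_gt0 m p_gt0)).
have {}Me : pr ^ (m - M%:Z) < e.
  by rewrite expfzDr ?gt_eqF// mulrC -ltr_pdivlMr ?exprz_gt0.
apply: filterS (Fr M) => y yM; rewrite Qp_ballE /=; apply: le_lt_trans Me.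
have -> : x - y = (x - Qp_of_rat p (r M)) - (y - Qp_of_rat p (r M)) by ring.
exact: Qp_normB_le.
Qed.

End QpCompact.

(** One integer gives both bounds: [z] serves as a common smaller exponent and [- z] as a common
    larger one. *)
Lemma seq_bound (T : eqType) (k : T -> int) (s : seq T) :
  exists z, forall j, j \in s -> z <= k j /\ k j <= - z.
Proof.
exists (- \sum_(j <- s) `|k j|) => j js; rewrite (big_rem j)//= opprK.
have : 0 <= \sum_(i <- rem j s) `|k i| by rewrite sumr_ge0.
by move: (\sum_(_ <- _) _) => t; lia.
Qed.

Lemma ord_bound n (k : 'I_n -> int) : exists z, forall j, z <= k j /\ k j <= - z.
Proof.
have [z zk] := seq_bound k (enum 'I_n); exists z => j.
by apply: zk; rewrite mem_enum.
Qed.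

Lemma compact_finite_cover (T : ptopologicalType) (I : choiceType) (A : set T)
    (f : I -> set T) : compact A -> (forall i, open (f i)) ->
  (forall x, A x -> exists i, f i x) ->
  exists s : seq I, forall x, A x -> exists2 i, i \in s & f i x.
Proof.
rewrite compact_cover => /(_ I setT f) h fo Af.
have [i _|x /Af[i fi]|s _ As] := h; [exact: fo|by exists i|].
by exists (finmap.enum_fset s) => x /As[i si fi]; exists i.
Qed.

Section Boxes.
Variables p n : nat.
Hypothesis p_prime : prime p.
Local Notation pr := (p%:R : rat).
Local Notation V := 'rV[Qp p]_n.
Implicit Types (x y a : V) (k l : 'I_n -> int) (z : int).

Let p_gt0 : 0 < pr. Proof. by rewrite ltr0n prime_gt0. Qed.
Let p_gt1 : 1 < pr. Proof. by rewrite ltr1n prime_gt1. Qed.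

(** The exponent depends on the coordinate because expanding a product over the coordinates mixes
    two different radii. *)
Definition box a k : set V := [set x | forall j, Qp_norm (x 0 j - a 0 j) <= pr ^ k j].

Definition cube a z := box a (fun=> z).

Lemma box_self a k : box a k a.
Proof. by move=> j; rewrite subrr Qp_norm0 exprz_ge0// (ltW p_gt0). Qed.

Lemma box0E k : box 0 k = [set x | forall j, Qp_norm (x 0 j) <= pr ^ k j].
Proof. by apply/seteqP; split=> x h j; have := h j; rewrite mxE subr0. Qed.

Lemma box_sym a x k : box a k x -> box x k a.
Proof. by move=> ax j; rewrite Qp_normB. Qed.

Lemma box_trans x a y k : box a k x -> box x k y -> box a k y.
Proof.
move=> ax xy j; have -> : y 0 j - a 0 j = (y 0 j - x 0 j) + (x 0 j - a 0 j) by ring.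
exact: Qp_normD_le.
Qed.

Lemma box_eq a x k : box a k x -> box x k = box a k.
Proof.
move=> ax; apply/seteqP; split=> y; first exact: box_trans.
by apply: box_trans; exact: box_sym.
Qed.

Lemma indic_box_eq (K : pzRingType) a k x y : box x k y ->
  \1_(box a k) y = \1_(box a k) x :> K.
Proof.
move=> xy; rewrite !indicE; congr (nat_of_bool _)%:R; apply/idP/idP; rewrite !inE => h.
  exact: box_trans h (box_sym xy).
exact: box_trans h xy.
Qed.

Lemma box_shift a k x y : box a k x = box (a + y) k (x + y).
Proof.
rewrite /box /=; apply: eq_forall => j; rewrite !mxE.
by have -> : x 0 j - a 0 j = x 0 j + y 0 j - (a 0 j + y 0 j) by ring.
Qed.

Lemma box_sub k l a : (forall j, k j <= l j) -> box a k `<=` box a l.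
Proof. by move=> kl x xk j; rewrite (le_trans (xk j))// ler_eXz2l. Qed.


Lemma nbhs_cubeP x (A : set V) : nbhs x A <-> exists z, cube x z `<=` A.
Proof.
split=> [/nbhs_ballP[e /= e0 eA]|[z zA]].
  have [M Me] := pexpN_lt p_prime e0; exists (- M%:Z) => y xy; apply: eA.
  split=> // i j; rewrite Qp_ballE /= (ord1 i) Qp_normB.
  by rewrite (le_lt_trans (xy j)).
apply/nbhs_ballP; exists (pr ^ z); first by rewrite /= exprz_gt0.
move=> y [_ xy]; apply: zA => j; have := xy 0 j.
by rewrite Qp_ballE /= Qp_normB => /ltW.
Qed.

Lemma open_box a k : open (box a k).
Proof.
rewrite openE => x ax; apply/nbhs_cubeP; have [z zk] := ord_bound k.
exists z => y xy; apply: (box_trans ax); apply: box_sub xy => j.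
by have [] := zk j.
Qed.

Lemma closed_box a k : closed (box a k).
Proof.
rewrite -[X in closed X]setCK closedC openE => x /= ax; apply/nbhs_cubeP.
have [z zk] := ord_bound k; exists z => y xy; apply: contra_not ax => ay.
apply: (box_trans ay); apply: box_sym; apply: box_sub xy => j.
by have [] := zk j.
Qed.

Lemma compact_box k : compact (box 0 k).
Proof.
have := rV_compact (fun j => @Qp_ball_compact p p_prime (k j)).
by rewrite box0E; congr (compact _); apply/seteqP.
Qed.

Lemma cube_meet a b z w : z <= w -> cube a z `&` cube b w !=set0 ->
  cube a z `<=` cube b w.
Proof.
move=> zw [x [ax bx]] y ay; apply: (box_trans bx).
by apply: (box_sub (k := fun=> z)) => //; apply: box_trans ay; exact: box_sym.
Qed.

Lemma cube_big x : exists z, cube 0 z x.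
Proof.
pose m j := projT1 (cid (Qp_norm_le_exp p_prime (x 0 j))).
have [z zm] := ord_bound (fun j => (m j)%:Z).
exists (- z) => j; rewrite mxE subr0.
rewrite (le_trans (projT2 (cid (Qp_norm_le_exp p_prime (x 0 j)))))// ler_eXz2l//.
by have [] := zm j.
Qed.

End Boxes.

(** * Test functions as finite combinations of indicators of cubes *)

Section TestFunctions.
Variables (p n : nat) (R : realType).
Hypothesis p_prime : prime p.
Local Notation V := 'rV[Qp p]_n.
Implicit Types (phi psi : V -> R[i]) (z m : int).

Definition cube_invariant z phi :=
  forall x y, cube x z y -> phi y = phi x.

(** Compactness of the support makes the radius of local constancy uniform. *)
Lemma test_functionsP psi : test_functions psi <->
  exists z m, cube_invariant z psi /\ forall x, psi x != 0 -> cube 0 m x.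
Proof.
split=> [[lc]|[z [m [zi ms]]]]; last first.
  split.
    by move=> x; apply/(nbhs_cubeP p_prime); exists z => y; exact: zi.
  apply: (@subclosed_compact _ _ (box 0 (fun=> m))).
  - exact: closed_closure.
  - exact: compact_box.
  by rewrite closureE => x; apply; split; [exact: closed_box|exact: ms].
rewrite /compactly_supported; set K := closure _ => cs.
have sK x : psi x != 0 -> K x by move=> x0; exact: subset_closure.
have [m mK] : exists m, K `<=` cube 0 m.
  have [m|x _|s sK'] := compact_finite_cover (f := cube 0) cs; first exact: open_box.
    exact: cube_big.
  have [m ms] := seq_bound id s.
  by exists (- m) => x /sK'[i /ms[_ im]]; exact: box_sub.
have lc' x : exists z, forall y, cube x z y -> psi y = psi x.
  by have /(nbhs_cubeP p_prime)[z xz] := lc x; exists z.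
pose zf x := projT1 (cid (lc' x)).
have zfP x y : cube x (zf x) y -> psi y = psi x := projT2 (cid (lc' x)) y.
(* Finitely many cubes of constancy cover [K]; the smallest of their radii works at every point of
   [K]. *)
have [z zK] : exists z, forall x y, K x -> cube x z y -> psi y = psi x.
  have [x|x _|s sK'] := compact_finite_cover (f := fun x => cube x (zf x)) cs.
  - exact: open_box.
  - by exists x; exact: box_self.
  have [z zs] := seq_bound zf s.
  exists z => x y /sK'[i /zs[zi _] ix] xy.
  by rewrite (zfP i x ix) (zfP i)//; apply: (box_trans ix); exact: box_sub xy.
exists z, m; split=> [x y xy|x /sK/mK//].
(* Off the support of [psi] invariance is checked from the other point: [y] is also a centre of the
   cube. *)
have [x0|/sK Kx] := eqVneq (psi x) 0; last exact: zK.
have [y0|/sK Ky] := eqVneq (psi y) 0; first by rewrite x0 y0.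
by apply/esym; apply: zK => //; exact: box_sym.
Qed.

Lemma test_functions_box a k : test_functions (\1_(box a k) : V -> R[i]).
Proof.
apply/test_functionsP; have [z zk] := ord_bound k.
have [w wa] := cube_big p_prime a.
exists z, (Num.max w (- z)); split=> [x y xy|x].
  have xy' : box x k y by apply: box_sub xy => // j; have [] := zk j.
  exact: indic_box_eq.
rewrite indicE; case: (boolP (x \in _)) => [|_]; last by rewrite eqxx.
rewrite inE => ax _.
have ax' : cube a (Num.max w (- z)) x.
  by apply: box_sub ax => // j; rewrite le_max; have [_ ->] := zk j; rewrite orbT.
by apply: box_trans ax'; apply: box_sub wa => // j; rewrite le_max lexx.
Qed.

Lemma test_functions_comp (f : R[i] -> R[i] -> R[i]) phi psi : f 0 0 = 0 ->
  test_functions phi -> test_functions psi ->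
  test_functions (fun x => f (phi x) (psi x)).
Proof.
move=> f0 /test_functionsP[z [m [zi ms]]] /test_functionsP[w [l [wi ls]]].
apply/test_functionsP; exists (Num.min z w), (Num.max m l); split=> [x y xy|x].
  rewrite (zi x y) ?(wi x y)//; apply: box_sub xy => // _.
    by rewrite ge_min lexx orbT.
  by rewrite ge_min lexx.
have [p0|/ms mx _] := eqVneq (phi x) 0; last first.
  by apply: box_sub mx => // _; rewrite le_max lexx.
have [q0|/ls lx _] := eqVneq (psi x) 0; first by rewrite p0 q0 f0 eqxx.
by apply: box_sub lx => // _; rewrite le_max lexx orbT.
Qed.

(** The factor [f] is only locally constant so that characters and constants qualify. *)
Lemma test_functionsM (f : V -> R[i]) psi : locally_constant f ->
  test_functions psi -> test_functions (fun x => f x * psi x).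
Proof.
move=> fc [pc ps]; split=> [x|].
  by near=> y; congr (_ * _); near: y; [exact: fc|exact: pc].
apply: (subclosed_compact (@closed_closure _ _) ps).
by apply: closure_subset => x /=; rewrite mulf_eq0 negb_or => /andP[].
Unshelve. all: by end_near. Qed.

(** Cover the support by finitely many cubes of the invariance radius. Subtracting the value of
    [psi] on the first cube leaves a function supported in the others, whence an induction on the
    list of centres. *)
Lemma test_functions_ind (P : (V -> R[i]) -> Prop) :
  P (fun=> 0) ->
  (forall psi c a z, P psi -> P (fun x => psi x + c * \1_(cube a z) x)) ->
  forall psi, test_functions psi -> P psi.
Proof.
move=> P0 PD psi /test_functionsP[z [m [zi ms]]].
have [s sm] : exists s : seq V, forall x, cube 0 m x -> exists2 c, c \in s & cube c z x.
  apply: (compact_finite_cover (f := fun x => cube x z)).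
  - exact: compact_box.
  - by move=> x; exact: open_box.
  - by move=> x _; exists x; exact: box_self.
have {ms sm} : forall x, psi x != 0 -> exists2 c, c \in s & cube c z x.
  by move=> x /ms/sm.
elim: s psi zi => [|c s IH] psi zi ss.
  suff -> : psi = (fun=> 0) by [].
  apply/funext => x; have [//|/ss[]] := eqVneq (psi x) 0.
  by move=> c; rewrite in_nil.
pose psi' x := psi x + (- psi c) * \1_(cube c z) x.
have psiE : psi = (fun x => psi' x + psi c * \1_(cube c z) x).
  by apply/funext => x; rewrite /psi' mulNr subrK.
rewrite psiE; apply: PD; apply: IH => [x y xy|x].
  by rewrite /psi' (zi x y xy); congr (_ + _ * _); exact: indic_box_eq.
rewrite /psi' indicE; case: (boolP (x \in _)) => [|xc].
  by rewrite inE => /zi ->; rewrite mulr1 subrr eqxx.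
rewrite mulr0 addr0 => /ss[d]; rewrite in_cons => /orP[/eqP-> dx|]; last by exists d.
by move: xc; rewrite notin_setE => /(_ dx).
Qed.

End TestFunctions.

(** * Additive characters *)

Section Cis.
Variable R : realType.
Implicit Types (s t : R).

Lemma cisD s t : cis (s + t) = cis s * cis t.
Proof. by rewrite /cis cosD sinD; congr (_ +i* _)%C; rewrite addrC. Qed.

Lemma cis0 : cis (0 : R) = 1.
Proof. by rewrite /cis cos0 sin0. Qed.

Lemma normc_cis t : ComplexField.Normc.normc (cis t) = 1.
Proof. by rewrite /cis /= cos2Dsin2 sqrtr1. Qed.

Lemma cis_neq0 t : cis t != 0.
Proof.
apply/eqP => t0; have := normc_cis t.
by rewrite t0 ComplexField.Normc.normc0 => /eqP; rewrite eq_sym oner_eq0.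
Qed.

Lemma cis_int t : t \is a Num.int -> cis (2 * pi * t) = 1.
Proof.
have cis2pi : cis (2 * pi : R) = 1.
  rewrite mulr_natl mulr2n cisD /cis cospi sinpi.
  by apply/eqP; rewrite eq_complex /=; apply/andP; split; apply/eqP; ring.
have cisn (m : nat) : cis (2 * pi * m%:R : R) = 1.
  elim: m => [|m IH]; first by rewrite mulr0 cis0.
  have -> : 2 * pi * m.+1%:R = 2 * pi * m%:R + 2 * pi :> R by rewrite -natr1; ring.
  by rewrite cisD IH cis2pi mulr1.
move=> /intrP[[m|m] ->]; first by rewrite -pmulrn.
rewrite NegzE mulrNz mulrN; apply: (mulfI (cis_neq0 (2 * pi * m.+1%:R))).
by rewrite -cisD -pmulrn subrr cis0 cisn mulr1.
Qed.

(** The real part is one minus twice the square of [sin (pi * t)], and this sine is positive. *)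
Lemma cis_neq1 t : 0 < t < 1 -> cis (2 * pi * t) != 1.
Proof.
move=> /andP[t0 t1]; apply/eqP => /(congr1 (@complex.Re R)) /=.
have -> : 2 * pi * t = (pi * t) *+ 2 by rewrite -mulrA mulr_natl.
rewrite cos_mulr2n => c1.
have s0 : 0 < sin (pi * t).
  by apply: sin_gt0_pi; rewrite mulr_gt0 ?pi_gt0//= gtr_pMr ?pi_gt0.
have := cos2Dsin2 (pi * t); have := mulr_gt0 s0 s0; rewrite -expr2.
by move: c1; rewrite mulr2n; lra.
Qed.

End Cis.

(** * Characters of Q_p^n and annihilators of boxes *)

Section Characters.
Variables (p n : nat) (R : realType).
Hypothesis p_prime : prime p.
Local Notation pr := (p%:R : rat).
Local Notation V := 'rV[Qp p]_n.
Local Notation chi := (@Qp_character p n R).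
Implicit Types (x y z a : V) (k : 'I_n -> int).

Let p_gt0 : 0 < pr. Proof. by rewrite ltr0n prime_gt0. Qed.
Let p_gt1 : 1 < pr. Proof. by rewrite ltr1n prime_gt1. Qed.

Lemma character_neq0 x y : chi x y != 0.
Proof. exact: cis_neq0. Qed.


Lemma characterC x y : chi x y = chi y x.
Proof. by congr (cis (_ * ratr _)); apply: eq_bigr => j _; rewrite mulrC. Qed.

(** A congruence modulo Z_p in each coordinate changes the exponent by an integer multiple of 2 pi.
    Biadditivity and triviality on integral products are both instances. *)
Lemma character_mul x y x' y' x'' y'' :
  (forall j, Qp_norm (x 0 j * y 0 j + x' 0 j * y' 0 j - x'' 0 j * y'' 0 j) <= 1) ->
  chi x y * chi x' y' = chi x'' y''.
Proof.
move=> h; rewrite /Qp_character -cisD -mulrDr -rmorphD /= -big_split /=.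
set s := \sum_j _; set t := \sum_j padic_frac (x'' 0 j * _).
rewrite -[s](subrK t) rmorphD /= mulrDr cisD cis_int ?mul1r//.
have : s - t \is a Num.int.
  rewrite /s /t -sumrB; apply: rpred_sum => j _.
  exact: (padic_frac_int p_prime (h j)).
by move=> /intrP[m ->]; rewrite ratr_int intr_int.
Qed.

Lemma characterDr x y z : chi x (y + z) = chi x y * chi x z.
Proof.
apply/esym/character_mul => j; rewrite !mxE mulrDr subrr.
by rewrite Qp_norm0.
Qed.

Lemma characterDl x y z : chi (x + y) z = chi x z * chi y z.
Proof. by rewrite characterC characterDr !(characterC z). Qed.

Lemma character_eq1 x y : (forall j, Qp_norm (x 0 j * y 0 j) <= 1) -> chi x y = 1.
Proof.
(* Cancelling [chi 0 0] avoids computing [padic_frac 0], which is controlled only modulo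
   integers. *)
move=> xy; apply: (mulIf (character_neq0 0 0)); rewrite mul1r.
by apply: character_mul => j; rewrite !mxE mulr0 subr0 addr0.
Qed.

(** With [character_nontrivial], this identifies the annihilator of a box as the box with opposite
    exponents. *)
Lemma character_dual k x y : box 0 (fun j => - k j) x -> box 0 k y -> chi x y = 1.
Proof.
move=> xk yk; apply: character_eq1 => j; have := xk j; have := yk j.
rewrite !mxE !subr0 Qp_normM => yj xj.
apply: (le_trans (ler_pM (Qp_norm_ge0 _) (Qp_norm_ge0 _) xj yj)).
by rewrite -expfzDr ?gt_eqF// addNr expr0z.
Qed.

Lemma padic_frac_of_rat (b : int) (l : nat) :
  padic_frac (Qp_of_rat p (b%:~R / pr ^+ l)) - b%:~R / pr ^+ l \is a Num.int.
Proof.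
set q := b%:~R / _; have [a [m [fE f1]]] := padic_fracP p_prime (Qp_of_rat p q).
have qE : padic_frac (Qp_of_rat p q) - q =
    (a * (p ^ l)%N - b * (p ^ m)%N)%:~R / pr ^+ (m + l).
  rewrite fE /q !(intrD, intrM, intrN, mulNr) -!pmulrn !natrX !exprD.
  by field; rewrite !expf_neq0 ?gt_eqF.
apply: (padic_integer p_prime qE).
by rewrite padic_normB -(Qp_norm_of_rat p) rmorphB.
Qed.

Lemma character_nontrivial k x : ~ box 0 (fun j => - k j) x ->
  exists2 y, box 0 k y & chi x y != 1.
Proof.
move=> /existsNP[j /negP]; rewrite mxE subr0 -ltNge => xj.
have x0 : x 0 j != 0.
  by apply: contraTneq xj => ->; rewrite Qp_norm0 -leNgt exprz_ge0// (ltW p_gt0).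
(* The witness makes the product with [x] equal to [1 / p], where the character is a nontrivial p-th
   root of unity. It stays in the box because discreteness leaves room for one factor [p]. *)
pose y : V := \row_i if i == j then p%:R^-1 / x 0 j else 0.
have nx : Qp_norm (x 0 j)^-1 <= pr ^ (k j - 1).
  apply: Qp_norm_lt_exp => //; rewrite Qp_normV -[pr ^ _]invrK ltf_pV2 ?posrE.
  - by rewrite invr_expz.
  - exact: Qp_norm_gt0.
  - by rewrite invr_gt0 exprz_gt0.
have np : Qp_norm ((p%:R : Qp p)^-1) = pr.
  by rewrite -exprN1 Qp_norm_expp// opprK expr1z.
exists y => [i|].
  rewrite !mxE subr0; case: eqP => [->|_]; last by rewrite Qp_norm0 exprz_ge0// (ltW p_gt0).
  rewrite Qp_normM np -ler_pdivlMl// mulrC (le_trans nx)//.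
  by rewrite expfzDr ?gt_eqF// exprN1.
rewrite /Qp_character; set s := \sum_i _.
have : s - 1%:~R / pr ^+ 1 \is a Num.int.
  rewrite /s (bigD1 j)//= mxE eqxx mulrCA mulfV// mulr1 addrAC rpredD//.
    have := padic_frac_of_rat 1 1.
    by rewrite rmorphM fmorphV rmorphXn rmorph1 !rmorph_nat mul1r expr1.
  apply: rpred_sum => i ij; rewrite mxE (negPf ij) mulr0.
  have := padic_frac_of_rat 0 0.
  by rewrite mul0r rmorph0 subr0.
rewrite expr1 mul1r => /intrP[m sm].
have -> : s = pr^-1 + m%:~R by rewrite -sm addrC subrK.
rewrite rmorphD /= ratr_int mulrDr cisD [X in _ * X]cis_int ?intr_int// mulr1.
rewrite cis_neq1// fmorphV rmorph_nat invr_gt0 ltr0n prime_gt0//=.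
by rewrite invf_lt1 ?ltr1n ?ltr0n ?prime_gt1 ?prime_gt0.
Qed.

Lemma locally_constant_character a : locally_constant (chi a).
Proof.
move=> x; apply/(nbhs_cubeP p_prime); have [m am] := cube_big p_prime a.
exists (- m) => y xy; rewrite -[y](subrK x) characterDr.
rewrite (@character_dual (fun=> - m)) ?mul1r//.
  by apply: box_sub am => // j; rewrite opprK.
by move=> j; have := xy j; rewrite !mxE subr0.
Qed.

End Characters.

(** * Haar measure of boxes *)

Section Haar.
Variables (p n : nat) (R : realType).
Variable mu : {measure set (borelQp p n) -> \bar R}.
Hypotheses (p_prime : prime p) (mu_haar : normalized_haar mu).
Local Notation pr := (p%:R : rat).
Local Notation V := 'rV[Qp p]_n.
Implicit Types (x y a : V) (k l : 'I_n -> int) (z : int).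

Let p_gt0 : 0 < pr. Proof. by rewrite ltr0n prime_gt0. Qed.
Let p_gt1 : 1 < pr. Proof. by rewrite ltr1n prime_gt1. Qed.
Let pR_gt0 : 0 < (p%:R : R). Proof. by rewrite ltr0n prime_gt0. Qed.

Lemma measurable_open_Qp (A : set V) : open A -> measurable (A : set (borelQp p n)).
Proof. by move=> oA; exact: sub_sigma_algebra. Qed.

Lemma measurable_box a k : measurable (box a k : set (borelQp p n)).
Proof. by apply: measurable_open_Qp; exact: open_box. Qed.

Lemma locally_constant_measurable d (U : measurableType d) (f : V -> U) :
  (forall x, \forall y \near x, f y = f x) ->
  measurable_fun setT (f : borelQp p n -> U).
Proof.
move=> fc _ B mB; rewrite setTI; apply: measurable_open_Qp.
rewrite openE => x /= fx; near=> y; rewrite /= (_ : f y = f x)//; near: y.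
exact: fc.
Unshelve. all: by end_near. Qed.

Lemma measurable_shift a :
  measurable_fun setT ((fun x => x + a) : borelQp p n -> borelQp p n).
Proof.
apply: (measurability (@open V : set (set (borelQp p n)))) => //.
move=> _ [A oA <-]; rewrite setTI; apply: measurable_open_Qp.
move: oA; rewrite !openE => oA x /= /oA /(nbhs_cubeP p_prime)[z zA].
apply/(nbhs_cubeP p_prime); exists z => y xy; apply: zA.
by rewrite /cube -box_shift.
Qed.

Lemma haar_shift a (A : set (borelQp p n)) : measurable A ->
  mu [set x : borelQp p n | A (x + a : V)] = mu A.
Proof.
move=> mA; rewrite -[RHS](mu_haar.1 (- a) A mA); congr (mu _).
apply/seteqP; split=> [x xA|_ [y yA <-]] /=.
  by exists (x + a : V) => //; rewrite addrC addrK.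
by rewrite addrAC addNr add0r.
Qed.

Lemma haar_box_center a k : mu (box a k) = mu (box 0 k).
Proof.
rewrite -(haar_shift a (measurable_box a k)); congr (mu _).
by apply/funext => x; rewrite /= [RHS](box_shift 0 k x a) add0r.
Qed.

Let upd k j z : 'I_n -> int := fun i => k i + (i == j)%:Z * z.

(** The enlarged box is a disjoint union of [p] translates of the old one, indexed by the leading
    digit of the [j]-th coordinate. *)
Lemma haar_box_step k j : (mu (box 0 (upd k j 1)) = p%:R%:E * mu (box 0 k))%E.
Proof.
pose z := k j + 1; have zk : z - 1 = k j by rewrite addrK.
pose c (d : nat) : V := \row_i if i == j then d%:R * p%:R ^ (- z) else 0.
have cj d : c d 0 j = d%:R * p%:R ^ (- z) by rewrite mxE eqxx.
have ci d i : i != j -> c d 0 i = 0 by rewrite mxE => /negPf ->.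
have uj : upd k j 1 j = z by rewrite /upd eqxx mulr1.
have ui i : i != j -> upd k j 1 i = k i by rewrite /upd => /negPf ->; rewrite mul0r addr0.
have -> : box 0 (upd k j 1) = \big[setU/set0]_(d < p) box (c d) k.
  rewrite -(bigcup_mkord p (fun d => box (c d) k)); apply/seteqP; split=> x.
    move=> xk; have := xk j; rewrite uj mxE subr0 => /(padic_digit_ball p_prime)[d dp xd].
    exists d => // i; have [->|ij] := eqVneq i j; first by rewrite cj -zk.
    by have := xk i; rewrite ci// ui// mxE.
  rewrite box0E; move=> [d /= dp xd] i; have := xd i.
  have [->|ij] := eqVneq i j; last by rewrite ci// ui// subr0.
  rewrite cj uj -zk => xj; rewrite -[x 0 j](subrK (d%:R * p%:R ^ (- z))).
  apply: Qp_normD_le; first by rewrite (le_trans xj)// ler_eXz2l//; lia.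
  rewrite Qp_normM Qp_norm_expp// opprK ler_piMl ?exprz_ge0 ?(ltW p_gt0)//.
  by rewrite -(rmorph_nat (@Qp_of_rat p)) Qp_norm_of_rat pmulrn padic_norm_int.
rewrite measure_bigsetU_ord //.
- rewrite (eq_bigr (fun=> mu (box 0 k))); last by move=> d _; exact: haar_box_center.
  by rewrite sumr_const card_ord mule_natl.
- by move=> d; exact: measurable_box.
apply/trivIsetP => d e _ _ de; rewrite -subset0 => x [/(_ j) xd /(_ j) xe].
move/negP: de; apply; apply/eqP/val_inj.
apply: (padic_digit_unique p_prime (ltn_ord d) (ltn_ord e) (z := z)).
rewrite zk -!cj.
have -> : c d 0 j - c e 0 j = (x 0 j - c e 0 j) - (x 0 j - c d 0 j) by ring.
exact: Qp_normB_le.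
Qed.

(** The induction moves one exponent at a time towards 0, where the box is the unit ball; negative
    exponents use the step backwards. *)
Lemma haar_box k : mu (box 0 k) = ((p%:R : R) ^ (\sum_j k j))%:E.
Proof.
have [N] := ubnP (\sum_j `|k j|%N)%N; elim: N k => // N IH k kN.
have [k0|] := boolP [forall j, k j == 0].
  rewrite big1; last by move=> j _; apply/eqP; move/forallP : k0.
  rewrite expr0z -mu_haar.2; congr (mu _).
  by rewrite box0E; apply/seteqP; split=> x h j; have := h j;
    move/forallP : k0 => /(_ j)/eqP ->.
rewrite negb_forall => /existsP[j kj].
have updK z : upd (upd k j (- z)) j z = k.
  by apply/funext => i; rewrite /upd mulrN subrK.
have sum_upd z : \sum_i upd k j z i = \sum_i k i + z.
  rewrite big_split /=; congr (_ + _).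
  by rewrite (bigD1 j)//= eqxx mul1r big1 ?addr0// => i /negPf ->; rewrite mul0r.
have abs_upd z : (`|(k j + z)%R| < `|k j|)%N -> (\sum_i `|upd k j z i| < N)%N.
  move=> lt; rewrite ltnS in kN; apply: leq_trans kN.
  rewrite (bigD1 j)//= [leqRHS](bigD1 j)//=.
  rewrite -addSn leq_add//; first by rewrite /upd eqxx mul1r.
  by apply: leq_sum => i /negPf ij; rewrite /upd ij mul0r addr0.
have [kpos|kneg] := ltP 0 (k j).
  rewrite -{1}(updK 1) haar_box_step IH; last by apply: abs_upd; lia.
  rewrite -EFinM sum_upd -[X in X * _]expr1z -expfzDr ?gt_eqF//; congr (_ ^ _)%:E; lia.
have := haar_box_step k j; rewrite IH; last by apply: abs_upd; lia.
rewrite sum_upd => h.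
(* An infinite measure has to be excluded before the step equation is divided by [p]. *)
have fin : mu (box 0 k) \is a fin_num.
  rewrite ge0_fin_numE// ltey; apply/eqP => oo; move: h.
  by rewrite oo gt0_muley ?lte_fin.
rewrite -(fineK fin) in h *; move: h; rewrite -EFinM => -[h]; congr EFin.
apply: (mulfI (lt0r_neq0 pR_gt0)); rewrite -h.
by rewrite addrC expfzDr ?gt_eqF// expr1z.
Qed.

End Haar.

(** * Fourier transforms of test functions *)

Section ComplexIntegral.
Context d (T : measurableType d) (R : realType).
Variable mu : {measure set T -> \bar R}.
Implicit Types (f g : T -> R[i]) (c : R[i]).

Lemma normc_ge0 (c : R[i]) : 0 <= ComplexField.Normc.normc c.
Proof. by case: c => a b; exact: sqrtr_ge0. Qed.

Definition cintegrable f :=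
  mu.-integrable setT (EFin \o (fun x => complex.Re (f x))) /\
  mu.-integrable setT (EFin \o (fun x => complex.Im (f x))).

Lemma Re_add (x y : R[i]) : complex.Re (x + y) = complex.Re x + complex.Re y.
Proof. by case: x; case: y. Qed.

Lemma Im_add (x y : R[i]) : complex.Im (x + y) = complex.Im x + complex.Im y.
Proof. by case: x; case: y. Qed.

(** The sign is attached to a coefficient so that the formula has the shape required by
    [integrable_comb]. *)
Lemma Re_mul (x y : R[i]) :
  complex.Re (x * y) = complex.Re x * complex.Re y + - complex.Im x * complex.Im y.
Proof. by case: x; case: y => *; rewrite /= mulNr. Qed.

Lemma Im_mul (x y : R[i]) :
  complex.Im (x * y) = complex.Re x * complex.Im y + complex.Im x * complex.Re y.
Proof. by case: x; case: y. Qed.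

Lemma integrable_comb (u v : T -> R) a b :
  mu.-integrable setT (EFin \o u) -> mu.-integrable setT (EFin \o v) ->
  mu.-integrable setT (EFin \o (fun x => a * u x + b * v x)).
Proof.
move=> iu iv; have := integrableD measurableT (integrableZl measurableT a iu)
  (integrableZl measurableT b iv).
exact: eq_integrable.
Qed.

Lemma Rintegral_comb (u v : T -> R) a b :
  mu.-integrable setT (EFin \o u) -> mu.-integrable setT (EFin \o v) ->
  (\int[mu]_x (a * u x + b * v x))%R = a * (\int[mu]_x u x)%R + b * (\int[mu]_x v x)%R.
Proof.
move=> iu iv; rewrite RintegralD ?RintegralZl//.
  exact: (integrableZl measurableT a iu).
exact: (integrableZl measurableT b iv).
Qed.

Lemma cintegrableD f g : cintegrable f -> cintegrable g ->
  cintegrable (fun x => f x + g x).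
Proof.
move=> [fr fi] [gr gi]; split.
  have := integrable_comb 1 1 fr gr; apply: eq_integrable => // x _ /=.
  by rewrite !mul1r Re_add.
have := integrable_comb 1 1 fi gi; apply: eq_integrable => // x _ /=.
by rewrite !mul1r Im_add.
Qed.

Lemma cintegrableZ c f : cintegrable f -> cintegrable (fun x => c * f x).
Proof.
move=> [fr fi]; split.
  have := integrable_comb (complex.Re c) (- complex.Im c) fr fi.
  by apply: eq_integrable => // x _ /=; rewrite Re_mul.
have := integrable_comb (complex.Re c) (complex.Im c) fi fr.
by apply: eq_integrable => // x _ /=; rewrite Im_mul.
Qed.

Lemma cintegralD f g : cintegrable f -> cintegrable g ->
  cintegral mu (fun x => f x + g x) = cintegral mu f + cintegral mu g.
Proof.
move=> [fr fi] [gr gi]; rewrite /cintegral.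
under eq_Rintegral do rewrite Re_add.
under [X in (_ +i* X)%C]eq_Rintegral do rewrite Im_add.
by rewrite !RintegralD.
Qed.

Lemma cintegralZ c f : cintegrable f ->
  cintegral mu (fun x => c * f x) = c * cintegral mu f.
Proof.
move=> [fr fi]; rewrite /cintegral.
under eq_Rintegral do rewrite Re_mul.
under [X in (_ +i* X)%C]eq_Rintegral do rewrite Im_mul.
rewrite !Rintegral_comb//; case: c => a b /=.
by apply/eqP; rewrite eq_complex /= mulNr !eqxx.
Qed.

Lemma Re_indic (A : set T) x : complex.Re (\1_A x : R[i]) = \1_A x.
Proof. by rewrite !indicE; case: (_ \in _). Qed.

Lemma Im_indic (A : set T) x : complex.Im (\1_A x : R[i]) = 0.
Proof. by rewrite !indicE; case: (_ \in _). Qed.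

Lemma cintegrable_indic (A : set T) : measurable A -> (mu A < +oo)%E ->
  cintegrable (\1_A : T -> R[i]).
Proof.
move=> mA Aoo; split.
  have -> : EFin \o (fun x => complex.Re (\1_A x : R[i])) = (fun x => (\1_A x)%:E).
    by apply/funext => x /=; rewrite Re_indic.
  apply/integrableP; split.
    by apply/measurable_EFinP; exact: measurable_indic.
  under eq_integral do rewrite gee0_abs ?lee_fin//.
  by rewrite integral_indic// setIT.
have -> : EFin \o (fun x => complex.Im (\1_A x : R[i])) = cst 0%E.
  by apply/funext => x /=; rewrite Im_indic.
exact: integrable0.
Qed.

Lemma cintegral_indic (A : set T) : measurable A ->
  cintegral mu (\1_A : T -> R[i]) = ((fine (mu A))%:C)%C.
Proof.
move=> mA; rewrite /cintegral; congr (_ +i* _)%C.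
  under eq_Rintegral do rewrite Re_indic.
  by rewrite /Rintegral integral_indic// setIT.
under eq_Rintegral do rewrite Im_indic.
by rewrite /Rintegral integral0.
Qed.

End ComplexIntegral.

Section FourierTest.
Variables (p n : nat) (R : realType).
Variable mu : {measure set (borelQp p n) -> \bar R}.
Hypotheses (p_prime : prime p) (mu_haar : normalized_haar mu).
Local Notation V := 'rV[Qp p]_n.
Local Notation chi := (@Qp_character p n R).
Implicit Types (x y a : V) (k l : 'I_n -> int) (z : int) (phi psi : V -> R[i]).

Lemma indic_box_shift (K : pzRingType) a c k x :
  \1_(box c k) (x + a) = \1_(box (c - a) k) x :> K.
Proof.
rewrite !indicE; congr (nat_of_bool _)%:R; apply/idP/idP; rewrite !inE;
  by rewrite (box_shift (c - a) k x a) subrK.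
Qed.

Lemma test_cmeasurable psi : test_functions psi ->
  cmeasurable (psi : borelQp p n -> R[i]).
Proof.
move=> [lc _]; split; apply: locally_constant_measurable => // x;
  by apply: filterS (lc x) => y ->.
Qed.

Lemma haar_box_lty a k : (mu (box a k) < +oo)%E.
Proof. by rewrite haar_box_center// haar_box// ltry. Qed.

Lemma test_cintegrable psi : test_functions psi -> cintegrable mu psi.
Proof.
move: psi; apply: test_functions_ind => // [|psi c a z ipsi].
  by split; exact: integrable0.
apply: cintegrableD => //; apply: cintegrableZ; apply: cintegrable_indic.
  exact: measurable_box.
exact: haar_box_lty.
Qed.

Lemma Rintegral_shift (g : borelQp p n -> R) a : measurable_fun setT g ->
  mu.-integrable setT (EFin \o (fun x => g (x + a : V))) ->
  (\int[mu]_x g (x + a : V))%R = (\int[mu]_x g x)%R.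
Proof.
move=> mg ig; rewrite /Rintegral; congr fine.
have := integral_pushforward (measurable_shift p_prime a) (f := EFin \o g) (D := setT).
rewrite preimage_setT => <- //.
  apply: (@eq_measure_integral _ _ _ _ mu (pushforward mu _)).
    exact: measurable_shift.
  by move=> ? A mA _; exact: (haar_shift mu_haar a mA).
exact/measurable_EFinP.
Qed.

Lemma locally_constant_cst (c : R[i]) : locally_constant ((fun=> c) : V -> R[i]).
Proof. by move=> x; apply/(nbhs_cubeP p_prime); exists 0. Qed.

Lemma test_functions0 : test_functions ((fun=> 0) : V -> R[i]).
Proof.
by apply/(test_functionsP p_prime); exists 0, 0; split=> // x; rewrite eqxx.
Qed.

Lemma test_shift psi a : test_functions psi -> test_functions (fun x => psi (x + a)).
Proof.
move: psi; apply: test_functions_ind => // [|psi c b z tpsi].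
  exact: test_functions0.
apply: (test_functions_comp p_prime (f := +%R)) => //; first by rewrite addr0.
have -> : (fun x => c * \1_(cube b z) (x + a)) = (fun x => c * \1_(cube (b - a) z) x).
  by apply/funext => x; rewrite indic_box_shift.
apply: test_functionsM => //; first exact: locally_constant_cst.
exact: test_functions_box.
Qed.

Lemma cintegral_shift psi a : test_functions psi ->
  cintegral mu (fun x : borelQp p n => psi (x + a : V)) = cintegral mu psi.
Proof.
move=> tpsi; have [mr mi] := test_cmeasurable tpsi.
have [ir ii] := test_cintegrable (test_shift a tpsi).
by congr (_ +i* _)%C; exact: Rintegral_shift.
Qed.

Lemma test_character_box a c k : test_functions (fun x => chi a x * \1_(box c k) x).
Proof.
apply: test_functionsM; first exact: locally_constant_character.
exact: test_functions_box.
Qed.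

(** Off the annihilator some [y] in the box has [chi b y != 1]. Translation by [y] preserves the box
    and multiplies the integral by [chi b y], which forces it to vanish. *)
Lemma cintegral_character_box b k :
  cintegral mu (fun x : borelQp p n => chi b x * \1_(box 0 k) (x : V)) =
  (((p%:R : R) ^ (\sum_j k j))%:C)%C * \1_(box 0 (fun j => - k j)) b.
Proof.
rewrite [in RHS]indicE; case: (boolP (b \in _)) => [|]; rewrite ?inE ?notin_setE => hb.
  have -> : (fun x => chi b x * \1_(box 0 k) x) = (\1_(box 0 k) : V -> R[i]).
    apply/funext => x; rewrite indicE; case: (boolP (x \in _)); last by rewrite mulr0.
    by rewrite inE mulr1 => xk; rewrite (character_dual _ p_prime hb).
  rewrite mulr1 cintegral_indic; last exact: measurable_box.
  by rewrite haar_box.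
rewrite mulr0; have [y yk y1] := character_nontrivial R p_prime hb.
set J := cintegral _ _.
have J1 : J = chi b y * J.
  rewrite -cintegralZ; last by apply: test_cintegrable; exact: test_character_box.
  rewrite {1}/J -(cintegral_shift y (test_character_box b 0 k)); congr cintegral.
  apply/funext => x; rewrite mulrA characterDr// [chi b y * _]mulrC; congr (_ * _).
  rewrite indic_box_shift sub0r -(@box_eq _ _ 0 (- y))// => j.
  by have := yk j; rewrite !mxE !subr0 Qp_normN.
apply/eqP; have /eqP : (1 - chi b y) * J = 0 by rewrite mulrBl mul1r -J1 subrr.
by rewrite mulf_eq0 subr_eq0 eq_sym (negPf y1).
Qed.

(** The modulation [a] moves the dual box to [- a], and the centre [c] survives only as a phase. *)
Lemma fourier_box a c k xi :
  fourier mu (fun x => chi a x * \1_(box c k) x) xi =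
  chi (xi + a) c * (((p%:R : R) ^ (\sum_j k j))%:C)%C * \1_(box (- a) (fun j => - k j)) xi.
Proof.
rewrite /fourier; under eq_fun do rewrite mulrA -characterDl//.
rewrite -(cintegral_shift c (test_character_box (xi + a) c k)).
have -> : (fun x : borelQp p n => chi (xi + a) (x + c : V) * \1_(box c k) (x + c : V)) =
    (fun x : borelQp p n => chi (xi + a) c * (chi (xi + a) x * \1_(box 0 k) (x : V))).
  apply/funext => x; rewrite characterDr// mulrA [chi _ c * _]mulrC; congr (_ * _).
  by rewrite indic_box_shift subrr.
rewrite cintegralZ; last by apply: test_cintegrable; exact: test_character_box.
rewrite cintegral_character_box mulrA; congr (_ * _).
by rewrite indic_box_shift sub0r.
Qed.

Lemma fourierD phi psi c xi : test_functions phi -> test_functions psi ->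
  fourier mu (fun x => phi x + c * psi x) xi = fourier mu phi xi + c * fourier mu psi xi.
Proof.
move=> tphi tpsi; rewrite /fourier -cintegralZ -?cintegralD.
- by congr cintegral; apply/funext => x; rewrite mulrDr [in RHS]mulrCA.
- by apply: test_cintegrable; apply: test_functionsM => //; exact: locally_constant_character.
- apply: cintegrableZ; apply: test_cintegrable; apply: test_functionsM => //.
  exact: locally_constant_character.
- by apply: test_cintegrable; apply: test_functionsM => //; exact: locally_constant_character.
Qed.

Lemma test_functionsDZ phi psi c : test_functions phi -> test_functions psi ->
  test_functions (fun x => phi x + c * psi x).
Proof.
move=> tphi tpsi; apply: (test_functions_comp p_prime (f := fun s t => s + c * t)) => //.
by rewrite mulr0 addr0.
Qed.

Lemma test_fourier psi : test_functions psi -> test_functions (fourier mu psi).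
Proof.
(* The induction carries [test_functions psi] along, because [fourierD] asks for it. *)
suff : test_functions psi -> test_functions psi /\ test_functions (fourier mu psi).
  by move=> h /h[].
move: psi; apply: test_functions_ind => // [|psi c a z [tpsi tfpsi]].
  split; first exact: test_functions0.
  have -> : fourier mu (fun=> 0) = (fun=> 0).
    apply/funext => xi; rewrite /fourier; under eq_fun do rewrite mulr0.
    by rewrite /cintegral /Rintegral /= integral0.
  exact: test_functions0.
have tb : test_functions (\1_(cube a z) : V -> R[i]) by exact: test_functions_box.
split; first exact: test_functionsDZ.
have -> : fourier mu (fun x => psi x + c * \1_(cube a z) x) =
    (fun xi => fourier mu psi xi + c * fourier mu (\1_(cube a z)) xi).
  by apply/funext => xi; rewrite fourierD.
apply: test_functionsDZ => //.
have -> : (\1_(cube a z) : V -> R[i]) = (fun x => chi 0 x * \1_(cube a z) x).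
  apply/funext => x; rewrite character_eq1 ?mul1r// => j.
  by rewrite mxE mul0r Qp_norm0.
have -> : fourier mu (fun x => chi 0 x * \1_(cube a z) x) = (fun xi =>
    chi xi a * ((((p%:R : R) ^ (\sum_(j < n) z))%:C)%C * \1_(box 0 (fun=> - z)) xi)).
  by apply/funext => xi; rewrite fourier_box addr0 oppr0 mulrA.
apply: test_functionsM.
  move=> xi; have := locally_constant_character R p_prime a xi.
  by apply: filterS => y; rewrite !(characterC _ a).
apply: test_functionsM; last exact: test_functions_box.
exact: locally_constant_cst.
Qed.

Lemma test_cLspace rho psi : 0 < rho -> test_functions psi -> cLspace mu rho psi.
Proof.
move=> rho0 tpsi; split; first exact: test_cmeasurable.
rewrite /cLnorm unlock /=; apply: poweR_lty.
(* The power of the modulus is itself a test function, so its integrability is already known. *)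
pose theta x := ((ComplexField.Normc.normc (psi x) `^ rho)%:C)%C.
have tt : test_functions theta.
  apply: (test_functions_comp p_prime
    (f := fun s _ => ((ComplexField.Normc.normc s `^ rho)%:C)%C) _ tpsi tpsi).
  by rewrite ComplexField.Normc.normc0 powR0// gt_eqF.
have [/integrableP[_ h] _] := test_cintegrable tt.
apply: le_lt_trans h; rewrite le_eqVlt; apply/orP; left; apply/eqP.
apply: eq_integral => x _ /=; congr (_%:E).
by rewrite [RHS]ger0_norm ?powR_ge0// ger0_norm// normc_ge0.
Qed.

End FourierTest.

(** * A density criterion in L^rho *)

Section ComplexLnorm.
Context d (T : measurableType d) (R : realType).
Variables (mu : {measure set T -> \bar R}) (rho : R).
Hypothesis rho1 : 1 <= rho.
Local Notation normc := (@ComplexField.Normc.normc R).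
Local Notation N := (cLnorm mu rho).
Implicit Types (f g : T -> R[i]) (c : R[i]) (A : set T).

Let rho_gt0 : 0 < rho. Proof. exact: lt_le_trans ltr01 rho1. Qed.

Definition cpower_integral f : \bar R := (\int[mu]_x (normc (f x) `^ rho)%:E)%E.

Lemma cLnormE f : N f = (cpower_integral f `^ rho^-1)%E.
Proof.
rewrite /cLnorm Lnorm.unlock /cpower_integral.
apply: (congr1 (fun t : \bar R => (t `^ rho^-1)%E)).
apply: eq_integral => x _.
by rewrite abse_EFin poweR_EFin ger0_norm ?normc_ge0.
Qed.

Lemma cpower_integral_ge0 f : (0 <= cpower_integral f)%E.
Proof. by apply: integral_ge0 => x _; rewrite lee_fin powR_ge0. Qed.

Lemma cLnorm_lt f (e : R) : 0 < e ->
  (cpower_integral f < (e `^ rho)%:E)%E -> (N f < e%:E)%E.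
Proof.
move=> e0; rewrite cLnormE; have := cpower_integral_ge0 f.
case: (cpower_integral f) => // r r0; rewrite lte_fin => re.
rewrite poweR_EFin lte_fin; rewrite lee_fin in r0.
have rhoV_gt0 : 0 < rho^-1 by rewrite invr_gt0.
apply: (@lt_le_trans _ _ ((e `^ rho) `^ rho^-1)).
  by apply: gt0_ltr_powR; rewrite ?nnegrE ?powR_ge0.
by rewrite -powRrM mulfV ?gt_eqF// powRr1// ltW.
Qed.

Lemma cLnorm_lty f : (N f < +oo)%E -> (cpower_integral f < +oo)%E.
Proof. by rewrite cLnormE; apply: lty_poweRy; rewrite invr_eq0 gt_eqF. Qed.

Lemma cmeasurable_normc f : cmeasurable f -> measurable_fun setT (normc \o f).
Proof.
move=> [mr mi].
have -> : normc \o f = (@Num.sqrt R) \o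
    (fun x => complex.Re (f x) ^+ 2 + complex.Im (f x) ^+ 2).
  by apply/funext => x /=; case: (f x).
apply: measurableT_comp.
  by apply: continuous_measurable_fun; exact: sqrt_continuous.
by apply: measurable_funD; exact: measurable_funX.
Qed.

Lemma cmeasurable_power f : cmeasurable f ->
  measurable_fun setT (fun x => (normc (f x) `^ rho)%:E).
Proof.
move=> /cmeasurable_normc mf; apply/measurable_EFinP.
exact: (measurableT_comp (measurable_powR rho) mf).
Qed.

Lemma cmeasurableD f g : cmeasurable f -> cmeasurable g ->
  cmeasurable (fun x => f x + g x).
Proof.
move=> [fr fi] [gr gi]; split.
  by under eq_fun do rewrite Re_add; exact: measurable_funD.
by under eq_fun do rewrite Im_add; exact: measurable_funD.
Qed.

Lemma cmeasurableZ c f : cmeasurable f -> cmeasurable (fun x => c * f x).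
Proof.
move=> [fr fi]; split.
  under eq_fun do rewrite Re_mul.
  by apply: measurable_funD; exact: measurable_funM.
under eq_fun do rewrite Im_mul.
by apply: measurable_funD; exact: measurable_funM.
Qed.

Lemma cmeasurableB f g : cmeasurable f -> cmeasurable g ->
  cmeasurable (fun x => f x - g x).
Proof.
move=> mf mg; have := cmeasurableD mf (cmeasurableZ (-1) mg).
by under eq_fun do rewrite mulN1r.
Qed.

Lemma cmeasurable_indic A : measurable A -> cmeasurable (\1_A : T -> R[i]).
Proof.
move=> mA; split.
  by under eq_fun do rewrite Re_indic; exact: measurable_indic.
by under eq_fun do rewrite Im_indic; exact: measurable_cst.
Qed.

Lemma cLnorm_le f g : cmeasurable f -> cmeasurable g ->
  (forall x, normc (f x) <= normc (g x)) -> (N f <= N g)%E.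
Proof.
move=> mf mg fg; rewrite !cLnormE; apply: gt0_ler_poweR.
- by rewrite invr_ge0 ltW.
- by rewrite in_itv/= cpower_integral_ge0 leey.
- by rewrite in_itv/= cpower_integral_ge0 leey.
apply: ge0_le_integral => //.
- by move=> x _; rewrite lee_fin powR_ge0.
- exact: cmeasurable_power.
- exact: cmeasurable_power.
- move=> x _; rewrite lee_fin ge0_ler_powR ?nnegrE ?normc_ge0//.
  exact: ltW.
Qed.

Lemma cLnormD f g : cmeasurable f -> cmeasurable g ->
  (N (fun x => f x + g x)%R <= N f + N g)%E.
Proof.
move=> mf mg; have mf' := cmeasurable_normc mf; have mg' := cmeasurable_normc mg.
apply: le_trans (minkowski_EFin mu mf' mg' rho1).
have := cLnorm_le (g := fun x => (normc (f x) + normc (g x))%:C%C)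
  (cmeasurableD mf mg).
set h := fun x => _%:C%C => h1.
have mh : cmeasurable h by split; [exact: measurable_funD|exact: measurable_cst].
have nh x : normc (h x) = normc (f x) + normc (g x).
  by rewrite /h /= expr0n /= addr0 sqrtr_sqr ger0_norm// addr_ge0 ?normc_ge0.
apply: (le_trans (h1 mh _)); last first.
  by rewrite /cLnorm; under eq_fun do rewrite nh.
by move=> x; rewrite nh; exact: le_normcD.
Qed.

Lemma cLnormZ c f : cmeasurable f -> N (fun x => c * f x)%R = ((normc c)%:E * N f)%E.
Proof.
move=> mf; rewrite !cLnormE.
have -> : cpower_integral (fun x => c * f x) = ((normc c `^ rho)%:E * cpower_integral f)%E.
  rewrite -ge0_integralZl//.
  - apply: eq_integral => x _.
    by rewrite ComplexField.Normc.normcM powRM ?normc_ge0// EFinM.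
  - exact: cmeasurable_power.
  - by move=> x _; rewrite lee_fin powR_ge0.
  - by rewrite lee_fin powR_ge0.
rewrite poweRM ?lee_fin ?powR_ge0 ?cpower_integral_ge0// poweR_EFin -powRrM.
by rewrite mulfV ?gt_eqF// powRr1 ?normc_ge0.
Qed.

Lemma cpower_integral_indic A : measurable A -> cpower_integral (\1_A) = mu A.
Proof.
move=> mA; rewrite -[X in mu X](setIT A) -integral_indic//.
apply: eq_integral => x _.
rewrite !indicE; case: (x \in A); first by rewrite ComplexField.Normc.normc1 powR1.
by rewrite ComplexField.Normc.normc0 powR0// gt_eqF.
Qed.

Lemma cLnorm_sum (I : Type) (s : seq I) (F : I -> T -> R[i]) (u : I -> \bar R) :
  (forall i, cmeasurable (F i)) -> (forall i, (N (F i) <= u i)%E) ->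
  cmeasurable (fun x => \sum_(i <- s) F i x) /\
  (N (fun x => \sum_(i <- s) F i x)%R <= \sum_(i <- s) u i)%E.
Proof.
move=> mF Fu; elim: s => [|i s [ms Ns]].
  under eq_fun do rewrite big_nil; split.
    by split; exact: measurable_cst.
  rewrite big_nil cLnormE (_ : cpower_integral _ = 0%E).
    by rewrite poweR0r// invr_eq0 gt_eqF.
  apply: integral0_eq => x _.
  by rewrite ComplexField.Normc.normc0 powR0// gt_eqF.
under eq_fun do rewrite big_cons; split; first exact: cmeasurableD.
by rewrite big_cons; apply: (le_trans (cLnormD (mF i) ms)); exact: leeD.
Qed.

End ComplexLnorm.

Lemma cvge0_lt (R : realType) (u : nat -> \bar R) (e : R) :
  u @ \oo --> 0%E -> 0 < e -> \forall k \near \oo, (u k < e%:E)%E.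
Proof.
move=> /fine_cvgP[fu /cvgrPdist_lt uc] e0; near=> k.
have fk : u k \is a fin_num by near: k.
rewrite -(fineK fk) lte_fin; apply: (le_lt_trans (ler_norm _)).
by rewrite -normrN -sub0r; near: k; exact: uc.
Unshelve. all: by end_near. Qed.

(** * From a generating pi-system to all of L^rho *)

Section DensityCriterion.
Context d (T : measurableType d) (R : realType).
Variables (mu : {measure set T -> \bar R}) (rho : R).
Hypothesis rho1 : 1 <= rho.
Local Notation normc := (@ComplexField.Normc.normc R).
Local Notation N := (cLnorm mu rho).
Variable X : set (T -> R[i]).
Hypothesis X_cLspace : X `<=` cLspace mu rho.
Hypothesis X_lin : forall f g c, X f -> X g -> X (fun x => f x + c * g x).
Implicit Types (f g : T -> R[i]) (c : R[i]) (A : set T).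

Let rho_gt0 : 0 < rho. Proof. exact: lt_le_trans ltr01 rho1. Qed.

Definition cLclosure : set (T -> R[i]) := [set f | cmeasurable f /\
  forall e : R, 0 < e -> exists2 g, X g & (N (fun x => f x - g x)%R < e%:E)%E].

Lemma cLclosureDZ f g c : cLclosure f -> cLclosure g ->
  cLclosure (fun x => f x + c * g x).
Proof.
move=> [mf fX] [mg gX]; split; first exact/cmeasurableD/cmeasurableZ.
move=> e e0; have [u Xu fu] := fX _ (divr_gt0 e0 (ltr0n _ 2)).
(* The added 1 keeps the divisor positive when [c = 0]. *)
have c0 : 0 < normc c + 1 by rewrite ltr_pwDr// normc_ge0.
have [v Xv gv] := gX _ (divr_gt0 (divr_gt0 e0 (ltr0n _ 2)) c0).
exists (fun x => u x + c * v x); first exact: X_lin.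
have mu' := (X_cLspace Xu).1; have mv' := (X_cLspace Xv).1.
have -> : (fun x => f x + c * g x - (u x + c * v x)) =
    (fun x => (f x - u x) + c * (g x - v x)).
  by apply/funext => x; rewrite mulrBr opprD addrACA.
apply: (le_lt_trans (cLnormD mu rho1 (cmeasurableB mf mu')
  (cmeasurableZ c (cmeasurableB mg mv')))).
rewrite cLnormZ//; last exact: cmeasurableB.
rewrite [e]splitr EFinD; apply: lte_leD => //.
  rewrite ge0_fin_numE ?mule_ge0 ?lee_fin ?normc_ge0 ?Lnorm_ge0//.
  by rewrite lte_mul_pinfty ?lee_fin ?normc_ge0// (lt_trans gv) ?ltry.
apply: (@le_trans _ _ ((normc c)%:E * (e / 2 / (normc c + 1))%:E)%E).
  by rewrite lee_wpmul2l ?lee_fin ?normc_ge0// ltW.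
rewrite -EFinM lee_fin mulrCA ler_piMr ?ltW ?divr_gt0//.
by rewrite ltr_pdivrMr// mul1r ltrDl.
Qed.

Lemma cLclosure_closed f : cmeasurable f ->
  (forall e : R, 0 < e -> exists2 g, cLclosure g & (N (fun x => f x - g x)%R < e%:E)%E) ->
  cLclosure f.
Proof.
move=> mf fX; split=> // e e0.
have [g [mg gX] fg] := fX _ (divr_gt0 e0 (ltr0n _ 2)).
have [h Xh gh] := gX _ (divr_gt0 e0 (ltr0n _ 2)).
exists h => //; have mh := (X_cLspace Xh).1.
have -> : (fun x => f x - h x) = (fun x => (f x - g x) + (g x - h x)).
  by apply/funext => x; rewrite addrA subrK.
apply: (le_lt_trans (cLnormD mu rho1 (cmeasurableB mf mg) (cmeasurableB mg mh))).
by rewrite [e]splitr EFinD; apply: lteD.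
Qed.

Variables (G : set (set T)) (B : nat -> set T).
Hypotheses (G_gen : @measurable _ T = <<s G >>) (G_I : setI_closed G).
Hypothesis G_X : forall A, G A -> cLclosure (\1_A).
Hypotheses (B_G : forall k, G (B k)) (B_lty : forall k, (mu (B k) < +oo)%E).
Hypothesis B_mono : forall k l, (k <= l)%N -> B k `<=` B l.
Hypothesis B_cover : forall x, exists k, B k x.

Let mB k : measurable (B k).
Proof. by rewrite G_gen; exact: sub_sigma_algebra. Qed.

Lemma cLclosure0 : cLclosure (fun=> 0).
Proof.
have := cLclosureDZ (-1) (G_X (B_G 0)) (G_X (B_G 0)).
by under eq_fun do rewrite mulN1r subrr.
Qed.

Lemma cLclosureZ f c : cLclosure f -> cLclosure (fun x => c * f x).
Proof.
by move=> fX; have := cLclosureDZ c cLclosure0 fX; under eq_fun do rewrite add0r.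
Qed.

Lemma cLclosureD f g : cLclosure f -> cLclosure g -> cLclosure (fun x => f x + g x).
Proof.
by move=> fX gX; have := cLclosureDZ 1 fX gX; under eq_fun do rewrite mul1r.
Qed.

Lemma cLclosureB f g : cLclosure f -> cLclosure g -> cLclosure (fun x => f x - g x).
Proof.
by move=> fX gX; have := cLclosureDZ (-1) fX gX; under eq_fun do rewrite mulN1r.
Qed.

Lemma cLclosure_sum (I : Type) (s : seq I) (F : I -> T -> R[i]) :
  (forall i, cLclosure (F i)) -> cLclosure (fun x => \sum_(i <- s) F i x).
Proof.
move=> FX; elim: s => [|i s IH].
  by under eq_fun do rewrite big_nil; exact: cLclosure0.
by under eq_fun do rewrite big_cons; exact: cLclosureD.
Qed.

(** The cut-off by [B k] keeps complements at finite measure, so the sets [A] with this property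
    form a lambda-system. *)
Lemma cLclosure_indic A k : measurable A -> cLclosure (\1_(A `&` B k)).
Proof.
move=> mA; pose P S := cLclosure (\1_(S `&` B k) : T -> R[i]).
suff : P A by []; move: A mA; rewrite G_gen.
apply: (dynkin_induction (P := P) G_gen G_I).
- by rewrite /P setTI; exact: G_X.
- by move=> S GS; apply: G_X; exact: G_I.
- move=> S mS PS; rewrite /P.
  have -> : (\1_(~` S `&` B k) : T -> R[i]) = (fun x => \1_(B k) x - \1_(S `&` B k) x).
    apply/funext => x; rewrite !indicE !in_setI in_setC.
    by case: (x \in S); case: (x \in B k); rewrite /= ?subr0 ?subrr.
  exact: cLclosureB (G_X (B_G k)) PS.
move=> F mF tF PF; set U := \bigcup_k F k.
pose V m := \big[setU/set0]_(i < m) F i.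
have mU : measurable U by exact: bigcup_measurable.
have mV m : measurable (V m) by exact: bigsetU_measurable.
have VU m : V m `<=` U by exact: bigsetU_bigcup.
have PV m : P (V m).
  elim: m => [|m IH]; rewrite /P /V.
    rewrite big_ord0 set0I; have -> : (\1_set0 : T -> R[i]) = (fun=> 0).
      by apply/funext => x; rewrite indicE in_set0.
    exact: cLclosure0.
  rewrite big_ord_recr /= -/(V m); have -> : (\1_((V m `|` F m) `&` B k) : T -> R[i]) =
      (fun x => \1_(V m `&` B k) x + \1_(F m `&` B k) x).
    apply/funext => x; rewrite !indicE !in_setI in_setU.
    case: (boolP (x \in F m)) => [Fx|]; last by rewrite orbF addr0.
    case: (boolP (x \in V m)) => [|_]; last by rewrite /= add0r.
    rewrite /V -bigcup_mkord inE => -[i /= im Fix].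
    have /trivIsetP/(_ i m I I) := tF; rewrite ltn_eqF// => /(_ isT) FF.
    by exfalso; rewrite -[False]/(set0 x) -FF; split=> //; rewrite inE in Fx.
  exact: cLclosureD IH (PF m).
(* The error sets decrease to the empty set inside [B k], whose finite measure gives continuity from
   above. *)
pose D m := (U `\` V m) `&` B k.
have mD m : measurable (D m) by apply: measurableI => //; exact: measurableD.
have D0 : mu (D m) @[m --> \oo] --> 0%E.
  have D_empty : \bigcap_m D m = set0.
    rewrite -subset0 => x Dx; have [[[i _ Fix] _] _] := Dx 0%N I.
    have [[_ +] _] := Dx i.+1 I; apply.
    by rewrite /V -bigcup_mkord; exists i => /=.
  rewrite -[X in _ --> X](measure0 mu) -D_empty; apply: nonincreasing_cvg_mu => //.
  - by apply: (le_lt_trans _ (B_lty k)); apply: le_measure; rewrite ?inE// => x [].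
  - by rewrite D_empty.
  move=> m l ml; apply/subsetPset => x [[Ux nVx] Bx]; split=> //; split=> //.
  apply: contra_not nVx; rewrite /V -!bigcup_mkord => -[i /= im Fi].
  by exists i => //=; exact: leq_trans im ml.
apply: cLclosure_closed; first by apply: cmeasurable_indic; exact: measurableI.
move=> e e0; have /cvge0_lt/(_ (powR_gt0 rho e0))[m _ /(_ m (leqnn m)) /= me] := D0.
exists (\1_(V m `&` B k)); first exact: PV.
have -> : (fun x => \1_(U `&` B k) x - \1_(V m `&` B k) x) = (\1_(D m) : T -> R[i]).
  apply/funext => x; rewrite !indicE [x \in D m]in_setI in_setD !in_setI.
  case: (boolP (x \in V m)) => [|_]; last by rewrite subr0 andbT.
  by rewrite andbF inE => /VU; rewrite -inE => ->; rewrite subrr.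
by apply: cLnorm_lt => //; rewrite cpower_integral_indic.
Qed.

Import HBNNSimple.

Lemma cLclosure_nnsfun (h : {nnsfun T >-> R}) k :
  cLclosure (fun x => ((h x * \1_(B k) x)%:C)%C).
Proof.
have -> : (fun x => ((h x * \1_(B k) x)%:C)%C) = (fun x =>
   \sum_(y <- finmap.enum_fset (fset_set (range h)))
     (y%:C)%C * \1_(h @^-1` [set y] `&` B k) x).
  apply/funext => x; rewrite {1}fimfunE fsbig_finite//= mulr_suml rmorph_sum.
  apply: eq_bigr => y _ /=; rewrite -mulrA rmorphM /=; congr (_ * _).
  by rewrite !indicE in_setI; do 2?case: (_ \in _); rewrite ?mulr0 ?mulr1 ?mul0r.
by apply: cLclosure_sum => y; apply: cLclosureZ; exact: cLclosure_indic.
Qed.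

Lemma cLclosure_ge0 (h : T -> R) : measurable_fun setT h -> (forall x, 0 <= h x) ->
  (\int[mu]_x (h x `^ rho)%:E < +oo)%E -> cLclosure (fun x => ((h x)%:C)%C).
Proof.
move=> mh h0 hoo.
have mh' : measurable_fun setT (EFin \o h) by exact/measurable_EFinP.
pose a k := nnsfun_approx measurableT mh' k.
have ah x : a k x @[k --> \oo] --> h x.
  have h0' y : setT y -> (0 <= (EFin \o h) y)%E by rewrite lee_fin.
  exact: (fine_cvg (cvg_nnsfun_approx measurableT mh' h0' I)).
have a_le k x : a k x <= h x.
  rewrite -(cvg_lim _ (ah x))//; apply: nondecreasing_cvgn_le.
    by move=> m l ml; have /(_ x) := lefP _ _ (nd_nnsfun_approx measurableT mh' ml).
  by apply/cvg_ex; exists (h x).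
(* The cut-off puts the simple function within reach of [cLclosure_nnsfun]; pointwise convergence is
   kept because [B] is increasing and exhausts the space. *)
pose b k x := a k x * \1_(B k) x.
have b_le k x : 0 <= b k x <= h x.
  rewrite /b indicE; case: (_ \in _); rewrite ?mulr1 ?mulr0 ?lexx ?h0//.
  by rewrite a_le andbT; exact: fun_ge0.
have bh x : b k x @[k --> \oo] --> h x.
  have [m Bm] := B_cover x; apply: cvg_trans (ah x); apply: near_eq_cvg.
  exists m => // k /= mk; rewrite /b indicE mem_set ?mulr1//.
  exact: B_mono mk _ Bm.
have mb k : measurable_fun setT (b k).
  by apply: measurable_funM; [exact: measurable_funPT|exact: measurable_indic].
have m_pow (u : T -> R) : measurable_fun setT u ->
    measurable_fun setT (fun x => (u x `^ rho)%:E).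
  move=> mu'; apply/measurable_EFinP.
  exact: (measurableT_comp (measurable_powR rho) mu').
have cvg0 : (\int[mu]_x ((h x - b k x) `^ rho)%:E)%E @[k --> \oo] --> 0%E.
  have [] := @dominated_convergence _ T R mu setT measurableT
    (fun k x => ((h x - b k x) `^ rho)%:E) (cst 0%E) (fun x => (h x `^ rho)%:E).
  - by move=> k; apply: (m_pow (fun x => h x - b k x)); exact: measurable_funB.
  - exact: measurable_cst.
  - apply: aeW => x _; apply/fine_cvgP; split; first exact: nearW.
    apply/cvgrPdist_lt => e e0.
    (* The threshold whose power of exponent [rho] is [e]. *)
    have e1 : 0 < e `^ rho^-1 by rewrite powR_gt0.
    have /cvgrPdist_lt/(_ _ e1) := bh x; apply: filterS => k /=.
    have /andP[b0 bx] := b_le k x.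
    rewrite sub0r normrN (ger0_norm (powR_ge0 _ _)) ger0_norm ?subr_ge0// => hb.
    have := gt0_ltr_powR rho_gt0 _ _ hb; rewrite !nnegrE subr_ge0 bx powR_ge0.
    by rewrite -powRrM mulVf ?gt_eqF// (powRr1 (ltW e0)); apply.
  - apply/integrableP; split; first exact: m_pow.
    by under eq_integral do rewrite gee0_abs ?lee_fin ?powR_ge0//.
  - apply: aeW => x k _; rewrite gee0_abs ?lee_fin ?powR_ge0//.
    have /andP[b0 bx] := b_le k x.
    by rewrite ge0_ler_powR ?nnegrE ?h0 ?subr_ge0 ?lerBlDr ?lerDl// ltW.
  by rewrite integral0.
apply: cLclosure_closed.
  by split => //; exact: measurable_cst.
move=> e e0; have /cvge0_lt/(_ (powR_gt0 rho e0))[k _ /(_ k (leqnn k)) /= ke] := cvg0.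
exists (fun x => ((b k x)%:C)%C); first exact: cLclosure_nnsfun.
have kE : cpower_integral mu rho (fun x => ((h x)%:C)%C - ((b k x)%:C)%C) =
    (\int[mu]_x ((h x - b k x) `^ rho)%:E)%E.
  apply: eq_integral => x _; rewrite -rmorphB /= expr0n /= addr0 sqrtr_sqr.
  by rewrite ger0_norm// subr_ge0; have /andP[] := b_le k x.
by apply: (cLnorm_lt rho1 e0); rewrite kE.
Qed.

(** The positive and negative parts of the real and imaginary parts are each bounded by the modulus
    of [f], so [cLclosure_ge0] applies to all four. *)
Lemma cLspace_cLclosure f : cLspace mu rho f -> cLclosure f.
Proof.
move=> [[mr mi] /(cLnorm_lty rho1) foo].
have part (u : T -> R) : measurable_fun setT u ->
    (forall x, `|u x| <= normc (f x)) -> cLclosure (fun x => ((Num.max (u x) 0)%:C)%C).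
  move=> mu' uf; have mm : measurable_fun setT (fun x => Num.max (u x) 0).
    by apply: measurable_maxr => //; exact: measurable_cst.
  have m0 x : 0 <= Num.max (u x) 0 by rewrite le_max lexx orbT.
  apply: (cLclosure_ge0 mm m0).
  apply: (@le_lt_trans _ _ (cpower_integral mu rho f)); last exact: foo.
  rewrite /cpower_integral.
  apply: ge0_le_integral.
  - exact: measurableT.
  - by move=> x _; rewrite lee_fin powR_ge0.
  - by apply/measurable_EFinP; exact: (measurableT_comp (measurable_powR rho) mm).
  - exact: cmeasurable_power.
  - move=> x _; rewrite lee_fin ge0_ler_powR ?nnegrE ?normc_ge0//; first exact: ltW.
    by rewrite (le_trans _ (uf x))// ge_max normr_ge0 ler_norm.
have norm_re x : `|complex.Re (f x)| <= normc (f x).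
  by case: (f x) => s t /=; rewrite -sqrtr_sqr ler_wsqrtr// lerDl sqr_ge0.
have norm_im x : `|complex.Im (f x)| <= normc (f x).
  by case: (f x) => s t /=; rewrite -sqrtr_sqr ler_wsqrtr// lerDr sqr_ge0.
have fE x : f x =
    ((Num.max (complex.Re (f x)) 0)%:C)%C - ((Num.max (- complex.Re (f x)) 0)%:C)%C
    + 'i%C * (((Num.max (complex.Im (f x)) 0)%:C)%C
              - ((Num.max (- complex.Im (f x)) 0)%:C)%C).
  have max_part (s : R) : s = Num.max s 0 - Num.max (- s) 0.
    by rewrite !maxEle oppr_le0; case: (leP s 0); case: (leP 0 s); lra.
  apply/eqP; rewrite eq_complex /=; apply/andP; split; apply/eqP.
    by rewrite {1}(max_part (complex.Re (f x))); ring.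
  by rewrite {1}(max_part (complex.Im (f x))); ring.
rewrite (funext fE); apply: cLclosureD; last apply: cLclosureZ; apply: cLclosureB;
  apply: part => // x; rewrite ?normrN//; exact: measurable_funN.
Qed.

End DensityCriterion.

(** * Approximation of cubes *)

Section Cubes.
Variables p n : nat.
Hypothesis p_prime : prime p.
Local Notation V := 'rV[Qp p]_n.

(** The empty set is included for stability under intersection. *)
Definition cubes : set (set (borelQp p n)) :=
  [set A | A = set0 \/ exists a z, A = cube (a : V) z].

Lemma cubes_setI : setI_closed cubes.
Proof.
have meet (a b : V) z w : z <= w -> cubes (cube a z `&` cube b w).
  move=> zw; have [->|/set0P ab] := eqVneq (cube a z `&` cube b w) set0; first by left.
  right; exists a, z; apply/seteqP; split=> x; first by case.
  by move=> ax; split=> //; apply: (cube_meet p_prime zw ab).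
move=> A B [->|[a [z ->]]] [->|[b [w ->]]]; rewrite ?set0I ?setI0; try by left.
by have [/meet|/ltW/meet] := leP z w => //; rewrite setIC.
Qed.

Lemma cube_rat (x : V) z : exists q : 'rV[rat]_n, cube (map_mx (Qp_of_rat p) q) z x.
Proof.
have e0 : 0 < (p%:R : rat) ^ z by rewrite exprz_gt0// ltr0n prime_gt0.
pose q j := projT1 (cid (Qp_of_rat_dense (x 0 j) e0)).
exists (\row_j q j) => j; rewrite !mxE ltW//.
exact: (projT2 (cid (Qp_of_rat_dense (x 0 j) e0))).
Qed.

(** Every point of a cube is a centre, so cubes with rational centres suffice to fill an open set,
    and there are countably many of them. *)
Lemma borelQp_cubes : @measurable _ (borelQp p n) = <<s cubes >>.
Proof.
apply/seteqP; split; last first.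
  apply: smallest_sub; first exact: sigma_algebra_measurable.
  by move=> _ [->|[a [z ->]]]; [exact: measurable0|exact: measurable_box].
apply: smallest_sub; first exact: smallest_sigma_algebra.
move=> U oU.
(* Codes of no cube, or of a cube not inside [U], contribute the empty set. *)
pose F k : set V := if @unpickle ('rV[rat]_n * int)%type k is Some (q, z) then
  (if `[< cube (map_mx (Qp_of_rat p) q) z `<=` U >] then
    cube (map_mx (Qp_of_rat p) q) z else set0) else set0.
have -> : U = \bigcup_k F k.
  apply/seteqP; split=> x.
    move: oU; rewrite openE => oU /oU /(nbhs_cubeP p_prime)[z xz].
    have [q qx] := cube_rat x z; exists (pickle (q, z)) => //.
    rewrite /F pickleK; case: asboolP => // nU; exfalso; apply: nU.
    by move=> y qy; apply: xz; apply: box_trans qy; exact: box_sym.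
  move=> [k _]; rewrite /F; case: unpickle => // -[q z].
  by case: asboolP => // qU /qU.
apply: (@bigcupT_measurable _ (g_sigma_algebraType cubes)) => k.
rewrite /F; case: unpickle => [[q z]|]; last exact: measurable0.
case: asboolP => _; last exact: measurable0.
by apply: sub_sigma_algebra; right; eexists; eexists.
Qed.

End Cubes.

Section CubeApproximation.
Variables (R : realType) (p n : nat) (rho : R).
Variable mu : {measure set (borelQp p n) -> \bar R}.
Hypotheses (p_prime : prime p) (rho_gt1 : 1 < rho).
Hypothesis mu_haar : normalized_haar mu.
Local Notation V := 'rV[Qp p]_n.
Local Notation chi := (@Qp_character p n R).
Local Notation pR := (p%:R : R).
Implicit Types (a : V) (f : {ffun 'I_n -> bool}).

Let pR_gt0 : 0 < pR. Proof. by rewrite ltr0n prime_gt0. Qed.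
Let pR_gt1 : 1 < pR. Proof. by rewrite ltr1n prime_gt1. Qed.

Lemma fourier_sum (I : Type) (s : seq I) (c : I -> R[i]) (F : I -> V -> R[i]) :
  (forall i, test_functions (F i)) ->
  test_functions (fun x => \sum_(i <- s) c i * F i x) /\
  forall xi, fourier mu (fun x => \sum_(i <- s) c i * F i x) xi =
    \sum_(i <- s) c i * fourier mu (F i) xi.
Proof.
move=> tF; elim: s => [|i s [tS fS]].
  under eq_fun do rewrite big_nil; split; first exact: test_functions0.
  move=> xi; rewrite big_nil; under eq_fun do rewrite -[0](mul0r 0).
  rewrite /fourier; under eq_fun do rewrite mul0r mulr0.
  by rewrite /cintegral /Rintegral /= integral0.
have E : (fun x => \sum_(j <- i :: s) c j * F j x) =
    (fun x => (\sum_(j <- s) c j * F j x) + c i * F i x).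
  by apply/funext => x; rewrite big_cons addrC.
rewrite E; split; first exact: test_functionsDZ.
by move=> xi; rewrite fourierD// fS big_cons addrC.
Qed.

(* The coordinates flagged by [f] carry the small box to be removed. *)
Let radii (r t : int) f : 'I_n -> int := fun j => if f j then - t else - r.

Let coef f : R[i] := \prod_j (if f j then -1 else 1).

(** [f] records which term is taken in each factor. The product shows the vanishing on the
    hyperplanes, the sum consists of boxes whose transforms are known. *)
Lemma prod_indic_box a (r t : int) (xi : V) :
  chi (- a) xi *
    \prod_j (\1_[set y : Qp p | Qp_norm y <= (p%:R : rat) ^ (- r)] (xi 0 j) -
             \1_[set y : Qp p | Qp_norm y <= (p%:R : rat) ^ (- t)] (xi 0 j)) =
  \sum_(f : {ffun 'I_n -> bool}) coef f * (chi (- a) xi * \1_(box 0 (radii r t f)) xi).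
Proof.
pose I (z : int) : set (Qp p) := [set y | Qp_norm y <= (p%:R : rat) ^ z].
pose u (j : 'I_n) (b : bool) : R[i] :=
  (if b then -1 else 1) * \1_(I (if b then - t else - r)) (xi 0 j).
transitivity (chi (- a) xi * \prod_j \sum_(b : bool) u j b).
  congr (_ * _); apply: eq_bigr => j _.
  by rewrite big_bool /u mulN1r mul1r addrC.
rewrite bigA_distr_bigA mulr_sumr; apply: eq_bigr => f _.
rewrite mulrCA; congr (_ * _); rewrite /u big_split /=; congr (_ * _).
rewrite indicE; case: (boolP (xi \in _)) => [|].
  rewrite inE box0E => xf; rewrite big1// => j _.
  by rewrite indicE mem_set// /I /=; have := xf j; rewrite /radii; case: (f j).
rewrite notin_setE box0E => /existsNP[j xj]; rewrite (bigD1 j)//= indicE.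
by rewrite memNset ?mul0r// /I /=; move: xj; rewrite /radii; case: (f j).
Qed.

Lemma normc_real (x : R) : ComplexField.Normc.normc (x%:C)%C = `|x|.
Proof. by rewrite /= expr0n /= addr0 sqrtr_sqr. Qed.

Let normc_coef f : ComplexField.Normc.normc (coef f) = 1.
Proof.
rewrite /coef; elim/big_ind: _ => [|x y x1 y1|j _].
- exact: ComplexField.Normc.normc1.
- by rewrite ComplexField.Normc.normcM x1 y1 mulr1.
case: (f j); last exact: ComplexField.Normc.normc1.
by rewrite normcN ComplexField.Normc.normc1.
Qed.

Lemma cLnorm_box a k : cLnorm mu rho (\1_(box a k) : V -> R[i]) =
  ((pR ^ (\sum_j k j)) `^ rho^-1)%:E.
Proof.
have rho1 : 1 <= rho by exact: ltW.
rewrite cLnormE cpower_integral_indic//; last exact: measurable_box.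
by rewrite haar_box_center// haar_box// poweR_EFin.
Qed.

(** One flagged side contributes [- t]; every other side is at most [|r|] since [- t] is
    nonpositive. *)
Let sum_radii (r : int) (t : nat) f : (exists j, f j) ->
  \sum_j radii r t f j <= \sum_(j < n) `|r| - t%:Z.
Proof.
move=> [j fj]; rewrite (bigD1 j)//= [X in _ <= X - _](bigD1 j)//= {1}/radii fj.
have : \sum_(i < n | i != j) radii r t f i <= \sum_(i < n | i != j) `|r|.
  by apply: ler_sum => i _; rewrite /radii; case: (f i); lia.
by move=> le_sum; rewrite [leRHS]addrAC lerD//; lia.
Qed.

(* The factors [mu H] and [(mu H^dual) ^ (1/rho)] of the error term multiply to
   [(mu H) ^ (1 - 1/rho)], which tends to 0 with [mu H] because [rho > 1]. *)
Lemma cube_approx a (z : int) (e : R) : 0 < e -> exists2 g, Phi_cross mu g &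
  (cLnorm mu rho (fun x => (\1_(cube a z) x : R[i]) - g x)%R < e%:E)%E.
Proof.
move=> e0; have rho1 : 1 <= rho by exact: ltW.
have rho0 : 0 < rho by exact: lt_trans ltr01 rho_gt1.
pose theta := 1 - rho^-1.
have theta0 : 0 < theta by rewrite subr_gt0 invf_lt1.
(* [K] is the inverse of the measure of the box without flags, so that the unflagged term is exactly
   the indicator of the cube. *)
pose m := #|{ffun 'I_n -> bool}|; pose K := pR ^ (\sum_(j < n) z).
have K0 : 0 < K by rewrite exprz_gt0.
(* The final sum has [m] terms of norm at most [del]; dividing by [m.+1] makes the total strictly
   less than [e]. *)
pose del := e / m.+1%:R; have del0 : 0 < del by rewrite divr_gt0.
pose M := \sum_(j < n) `|z|.
(* [M - t] bounds the exponent of the measure of every flagged box; raising to the power [theta]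
   then leaves less than [del / K]. *)
have [t tM] : exists t : nat, pR ^ (M - t%:Z) < (del / K) `^ theta^-1.
  have [t te] := pexpN_lt p_prime (divr_gt0 (powR_gt0 theta^-1 (divr_gt0 del0 K0))
    (exprz_gt0 M pR_gt0)).
  by exists t; rewrite expfzDr ?gt_eqF// mulrC -ltr_pdivlMr ?exprz_gt0.
have small f : (exists j, f j) ->
    K * (pR ^ (\sum_j radii z t f j) * (pR ^ (\sum_j - radii z t f j)) `^ rho^-1) <= del.
  move=> /(sum_radii z t); rewrite -/M => sf; rewrite -ler_pdivlMl// [leRHS]mulrC.
  rewrite sumrN -!powR_intmul ?(ltW pR_gt0)// -powRrM -powRD; last first.
    by rewrite (gt_eqF pR_gt0) implybT.
  set s := \sum_j _ in sf *.
  have -> : s%:~R + (- s)%:~R / rho = s%:~R * theta :> R.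
    by rewrite mulrNz mulNr /theta mulrBr mulr1.
  apply: (@le_trans _ _ (pR `^ ((M - t%:Z)%:~R * theta))).
    by rewrite ler_powR ?(ltW pR_gt1)// ler_pM2r// ler_int.
  rewrite powRrM powR_intmul ?(ltW pR_gt0)// ltW//.
  have /(gt0_ltr_powR theta0) := tM; rewrite !nnegrE powR_ge0 exprz_ge0 ?(ltW pR_gt0)//.
  by move=> /(_ isT isT); rewrite -powRrM mulVf ?gt_eqF// powRr1// divr_ge0 ?ltW.
pose c f : R[i] := (K%:C)%C * coef f.
pose F f (x : V) : R[i] := chi (- a) x * \1_(box 0 (radii z t f)) x.
have tF f : test_functions (F f) by exact: test_character_box.
have [tpsi fpsi] := fourier_sum (index_enum _) c tF.
set psi := fun x => _ in tpsi fpsi.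
exists (fourier mu psi).
  exists psi => //; split=> // j xi xij; rewrite /psi.
  under eq_bigr do rewrite /c -mulrA.
  (* On the [j]-th hyperplane both indicators in the [j]-th factor equal 1 and cancel. *)
  rewrite -mulr_sumr -prod_indic_box (bigD1 j)//= xij !indicE !mem_set ?subrr ?mul0r ?mulr0//.
    by rewrite /= Qp_norm0 exprz_ge0.
  by rewrite /= Qp_norm0 exprz_ge0.
pose f0 : {ffun 'I_n -> bool} := [ffun=> false].
(* The coefficient at [f0] is 0 because that term cancels the indicator of the cube. *)
pose gc f := if f == f0 then 0 else - (c f * ((pR ^ (\sum_j radii z t f j))%:C)%C).
pose G f (x : borelQp p n) : R[i] :=
  gc f * \1_(box a (fun j => - radii z t f j)) (x : V).
have f0P f : f != f0 -> exists j, f j.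
  move=> ff0; apply: contrapT => /forallNP nf; move/negP: ff0; apply.
  by apply/eqP/ffunP => j; rewrite ffunE; apply/negP; exact: nf.
have radii0 : radii z t f0 = fun=> - z by apply/funext => j; rewrite /radii ffunE.
have -> : (fun x => (\1_(cube a z) x : R[i]) - fourier mu psi x) =
    (fun x => \sum_(f <- index_enum {ffun 'I_n -> bool}) G f x).
  apply/funext => x; rewrite fpsi (bigD1 f0)//= [RHS](bigD1 f0)//=.
  rewrite {1}/G {1}/gc eqxx mul0r add0r.
  have term f : c f * fourier mu (F f) x =
      c f * ((pR ^ (\sum_j radii z t f j))%:C)%C * \1_(box a (fun j => - radii z t f j)) x.
    rewrite /F fourier_box // (_ : - - a = a) ?opprK //.
    rewrite characterC character_eq1 ?mul1r ?mulrA// => j.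
    by rewrite mxE mul0r Qp_norm0.
  rewrite term radii0 /c /coef big1; last by move=> j _; rewrite ffunE.
  rewrite mulr1 -rmorphM /= sumrN -expfzDr ?gt_eqF// subrr expr0z mul1r.
  have -> : box a (fun=> - - z) = cube a z by rewrite opprK.
  rewrite opprD addrA subrr add0r -sumrN; apply: eq_bigr => f ff0.
  by rewrite term /G /gc (negPf ff0) mulNr.
have mG f : cmeasurable (G f : borelQp p n -> R[i]).
  by apply: cmeasurableZ; apply: cmeasurable_indic; exact: measurable_box.
have NG f : (cLnorm mu rho (G f) <= del%:E)%E.
  rewrite cLnormZ//; last by apply: cmeasurable_indic; exact: measurable_box.
  rewrite cLnorm_box -EFinM lee_fin /gc; case: (eqVneq f f0) => [_|/f0P ff].
    by rewrite ComplexField.Normc.normc0 mul0r ltW.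
  rewrite normcN !ComplexField.Normc.normcM !normc_real normc_coef mulr1.
  rewrite !gtr0_norm ?exprz_gt0// -mulrA; exact: small.
have [_ /le_lt_trans] := cLnorm_sum rho1 (index_enum {ffun 'I_n -> bool}) mG NG.
apply; rewrite sumEFin lte_fin sumr_const -/m -mulr_natr mulrAC.
by rewrite ltr_pdivrMr// ltr_pM2l// ltr_nat.
Qed.

End CubeApproximation.

Theorem lemma3p5 (R : realType) (p n : nat) (rho : R)
    (mu : {measure set (borelQp p n) -> \bar R}) :
  prime p -> (0 < n)%N -> 1 < rho -> normalized_haar mu ->
  dense_in_cLspace mu rho (Phi_cross mu).
Proof.

move=> p_prime n_gt0 rho_gt1 mu_haar.
have rho0 : 0 < rho by exact: lt_trans ltr01 rho_gt1.
pose X : set (borelQp p n -> R[i]) := Phi_cross mu.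
have X_cLspace : X `<=` cLspace mu rho.
  by move=> _ [psi [tpsi _] <-]; apply: test_cLspace => //; exact: test_fourier.
split=> // f fL.
have X_lin (g h : borelQp p n -> R[i]) c : X g -> X h -> X (fun x => g x + c * h x).
  move=> [phi [tphi phi0] <-] [psi [tpsi psi0] <-].
  exists (fun x => phi x + c * psi x); last first.
    by apply/funext => xi; rewrite fourierD.
  split; first exact: test_functionsDZ.
  by move=> j xi xij; rewrite (phi0 j)// (psi0 j)// mulr0 addr0.
have cube_X a z : cLclosure mu rho X (\1_(cube (a : 'rV[Qp p]_n) z)).
  split; first by apply: cmeasurable_indic; exact: measurable_box.
  by move=> e e0; exact: cube_approx.
have cubes_X A : cubes A -> cLclosure mu rho X (\1_A).
  move=> [->|[a [z ->]]]; last exact: cube_X.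
  have := cLclosureDZ (ltW rho_gt1) X_cLspace X_lin (-1) (cube_X 0 0) (cube_X 0 0).
  congr (cLclosure _ _ _ _); apply/funext => x.
  by rewrite mulN1r subrr indicE in_set0.
pose B (k : nat) : set (borelQp p n) := cube 0 k%:Z.
have B_cubes k : cubes (B k) by right; exists 0, k%:Z.
have B_lty k : (mu (B k) < +oo)%E by exact: haar_box_lty.
have B_mono k l : (k <= l)%N -> B k `<=` B l.
  by move=> kl; apply: box_sub => // _; rewrite lez_nat.
have B_cover x : exists k, B k x.
  have [z xz] := cube_big p_prime x; exists `|z|%N.
  by apply: box_sub xz => // _; rewrite lez_abs.
exact: (cLspace_cLclosure (ltW rho_gt1) X_cLspace X_lin (borelQp_cubes n p_prime)
  (cubes_setI p_prime) cubes_X B_cubes B_lty B_mono B_cover fL).2.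
Qed.
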